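(* Let $T$ be a complete theory with monster model $\mathcal{U}$. Suppose $\mu\in\mathfrak{M}_x(\mathcal{U})$ and $\nu\in\mathfrak{M}_y(\mathcal{U})$ are Borel definable over a small set $A\subset\mathcal{U}$, and at least one of $\mu$, $\nu$ is definable over $A$. Then $\mu\otimes\nu$ is Borel definable over $A$ and, for every $\lambda\in\mathfrak{M}_z(\mathcal{U})$, $(\mu\otimes\nu)\otimes\lambda=\mu\otimes(\nu\otimes\lambda)$.
   Context: $\mathfrak{M}_x(B)$ denotes Keisler measures (finitely additive probability measures on $\mathcal{L}_B$-formulas in $x$ modulo $T$), identified with regular Borel probability measures on $S_x(B)$. $\mu\in\mathfrak{M}_x(\mathcal{U})$ is invariant over small $A$ if $\mu(\phi(x,b))=\mu(\phi(x,b'))$ whenever $b\equiv_A b'$; then $F^\phi_{\mu,A}\colon S_y(A)\to[0,1]$, $q\mapsto\mu(\phi(x,b))$ for $b\models q$. $\mu$ is Borel definable (resp. definable) over $A$ if it is $A$-invariant and $F^\phi_{\mu,A}$ is Borel (resp. continuous) for every $\mathcal{L}$-formula $\phi(x,y)$. Morley product: for $\mu$ Borel definable over $A$ and $\nu\in\mathfrak{M}_y(\mathcal{U})$, $(\mu\otimes\nu)(\phi(x,y))=\int_{S_y(B)}F^\phi_{\mu,B}\,d(\nu|_B)$ with $B\supseteq A$ small and $\phi$ over $B$. *)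

(* Defs.v *)
From HB Require Import structures.
From mathcomp Require Import all_boot all_order all_algebra.
From mathcomp Require Import all_classical all_reals all_analysis.

Set Implicit Arguments.
Unset Strict Implicit.
Unset Printing Implicit Defensive.
Import Order.TTheory GRing.Theory Num.Theory.
Import numFieldNormedType.Exports.
Local Open Scope classical_set_scope.
Local Open Scope card_scope.
Local Open Scope ring_scope.

(** * First-order logic *)

Record language := Language {
  fsym : Type;
  farity : fsym -> nat;
  rsym : Type;
  rarity : rsym -> nat }.

(* The free variables of a [formula L V] are elements of the type [V]. A
   quantifier binds the variable [None] of [option V], so renaming free
   variables is capture-free by construction. *)
Inductive term (L : language) (V : Type) : Type :=
| Var of V
| App (f : fsym L) of ('I_(farity f) -> term L V).

Inductive formula (L : language) (V : Type) : Type :=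
| FTrue
| FEq of term L V & term L V
| FRel (r : rsym L) of ('I_(rarity r) -> term L V)
| FNot of formula L V
| FAnd of formula L V & formula L V
| FEx of formula L (option V).

Arguments FTrue {L V}.

Definition FOr (L : language) (V : Type) (phi psi : formula L V) : formula L V :=
  FNot (FAnd (FNot phi) (FNot psi)).

Definition sentence (L : language) := formula L void.

Fixpoint trename (L : language) (V W : Type) (g : V -> W) (t : term L V) :
    term L W :=
  match t with
  | Var v => Var L (g v)
  | App f ts => App (fun i => trename g (ts i))
  end.

Fixpoint frename (L : language) (V W : Type) (g : V -> W) (phi : formula L V) :
    formula L W :=
  match phi with
  | FTrue => FTrue
  | FEq t1 t2 => FEq (trename g t1) (trename g t2)
  | FRel r ts => FRel (fun i => trename g (ts i))
  | FNot phi => FNot (frename g phi)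
  | FAnd phi psi => FAnd (frename g phi) (frename g psi)
  | FEx phi => FEx (frename (omap g) phi)
  end.

Fixpoint tvars (L : language) (V : Type) (t : term L V) : set V :=
  match t with
  | Var v => [set v]
  | App f ts => [set v | exists i, tvars (ts i) v]
  end.

Fixpoint fvars (L : language) (V : Type) (phi : formula L V) : set V :=
  match phi with
  | FTrue => set0
  | FEq t1 t2 => tvars t1 `|` tvars t2
  | FRel r ts => [set v | exists i, tvars (ts i) v]
  | FNot phi => fvars phi
  | FAnd phi psi => fvars phi `|` fvars psi
  | FEx phi => [set v | fvars phi (Some v)]
  end.

(* [pointedType]: first-order structures are nonempty. *)
Record structure (L : language) := Structure {
  dom :> pointedType;
  finterp : forall f : fsym L, ('I_(farity f) -> dom) -> dom;
  rinterp : forall r : rsym L, ('I_(rarity r) -> dom) -> Prop }.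

Fixpoint teval (L : language) (M : structure L) (V : Type) (v : V -> M)
    (t : term L V) : M :=
  match t with
  | Var x => v x
  | App f ts => finterp (fun i => teval v (ts i))
  end.

Fixpoint holds (L : language) (M : structure L) (V : Type) (v : V -> M)
    (phi : formula L V) : Prop :=
  match phi with
  | FTrue => True
  | FEq t1 t2 => teval v t1 = teval v t2
  | FRel r ts => rinterp (fun i => teval v (ts i))
  | FNot phi => ~ holds v phi
  | FAnd phi psi => holds v phi /\ holds v psi
  | FEx phi => exists a : M, holds (fun o => if o is Some x then v x else a) phi
  end.

Definition satisfies (L : language) (M : structure L) (s : sentence L) : Prop :=
  holds (fun o : void => match o return M with end) s.

Definition model (L : language) (T : set (sentence L)) (M : structure L) : Prop :=
  forall s, T s -> satisfies M s.

Definition complete_theory (L : language) (T : set (sentence L)) : Prop :=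
  (exists M : structure L, model T M) /\
  forall s : sentence L,
    (forall M : structure L, model T M -> satisfies M s) \/
    (forall M : structure L, model T M -> satisfies M (FNot s)).

(** * Formulas with parameters *)

(* Parameters are treated as variables assigned to themselves: an L_U-formula
   in the finite tuple of variables x = (x_i)_(i : X) is a [formula L (X + U)],
   and the tuples of sort x in U are the functions [X -> U]. *)
Definition sat (L : language) (U : structure L) (X : Type)
    (phi : formula L (X + U)) (a : X -> U) : Prop :=
  holds (fun v => match v with inl x => a x | inr u => u end) phi.

Definition params (L : language) (U : structure L) (X : Type)
    (phi : formula L (X + U)) : set U := [set u | fvars phi (inr u)].

Definition formula_over (L : language) (U : structure L) (X : Type)
    (B : set U) : set (formula L (X + U)) := [set phi | params phi `<=` B].

Definition no_params (L : language) (U : structure L) (V : Type)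
    (phi : formula L V) : formula L (V + U) := frename inl phi.

(* phi(x,y) |-> phi(x,b) *)
Definition inst (L : language) (U : structure L) (X Y : Type)
    (phi : formula L ((X + Y) + U)) (b : Y -> U) : formula L (X + U) :=
  frename (fun v => match v with
                    | inl (inl x) => inl x
                    | inl (inr y) => inr (b y)
                    | inr u => inr u
                    end) phi.

(* b ≡_A b' *)
Definition equiv_over (L : language) (U : structure L) (Y : Type) (A : set U)
    (b b' : Y -> U) : Prop :=
  forall psi : formula L (Y + U),
    formula_over A psi -> (sat psi b <-> sat psi b').

(** * Spaces of complete types *)

Record complete_type (L : language) (U : structure L) (X : Type) (B : set U)
    (p : set (formula L (X + U))) : Prop := CompleteType {
  ct_over : p `<=` formula_over B;
  ct_consistent : forall s : set (formula L (X + U)),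
    finite_set s -> s `<=` p -> exists a : X -> U, forall phi, s phi -> sat phi a;
  ct_complete : forall phi, formula_over B phi -> p phi \/ p (FNot phi) }.

(* S_x(B) *)
Record type_space (L : language) (U : structure L) (X : Type) (B : set U) :=
  TypeSpace {
    type_set : set (formula L (X + U));
    type_setP : complete_type B type_set }.

Arguments type_space {L U} X B.

Definition realizes (L : language) (U : structure L) (X : Type) (B : set U)
    (b : X -> U) (q : type_space X B) : Prop := forall phi, type_set q phi -> sat phi b.

(* tp(a/B) *)
Lemma tp_complete (L : language) (U : structure L) (X : Type) (B : set U)
  (a : X -> U) : complete_type B [set phi | formula_over B phi /\ sat phi a].
Proof.
split=> [phi []//|s _ sp|phi Bphi].
  by exists a => phi /sp [].
by have [?|?] := pselect (sat phi a); [left|right].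
Qed.

Definition tp (L : language) (U : structure L) (X : Type) (B : set U)
  (a : X -> U) : type_space X B := TypeSpace (tp_complete B a).

HB.instance Definition _ (L : language) (V : Type) :=
  gen_eqMixin (formula L V).
HB.instance Definition _ (L : language) (V : Type) :=
  gen_choiceMixin (formula L V).
HB.instance Definition _ (L : language) (V : Type) :=
  isPointed.Build (formula L V) FTrue.

HB.instance Definition _ (L : language) (U : structure L) (X : Type)
  (B : set U) := gen_eqMixin (type_space X B).
HB.instance Definition _ (L : language) (U : structure L) (X : Type)
  (B : set U) := gen_choiceMixin (type_space X B).
HB.instance Definition _ (L : language) (U : structure L) (X : Type)
  (B : set U) := isPointed.Build (type_space X B) (tp B (fun=> point)).

(* the topology generated by the sets [phi], for phi over B *)
HB.instance Definition _ (L : language) (U : structure L) (X : Type)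
  (B : set U) := isSubBaseTopological.Build (type_space X B)
    (formula_over B : set (formula L (X + U)))
    (fun phi => [set p | type_set p phi]).

(** * Monster models *)

Definition card_lt (S1 S2 : Type) (A : set S1) (B : set S2) : Prop :=
  (A #<= B) && ~~ (B #<= A).

(* The cardinal kappa is represented by a type [K] of that cardinality. *)
Definition small (K S : Type) (A : set S) : Prop := card_lt A [set: K].

Definition saturated (K : Type) (L : language) (U : structure L) : Prop :=
  forall (B : set U) (X : finType) (p : type_space X B),
    small K B -> exists b, realizes b p.

Record automorphism (L : language) (U : structure L) (s : U -> U) : Prop :=
  Automorphism {
    aut_bij : bijective s;
    aut_fun : forall (f : fsym L) (a : 'I_(farity f) -> U),
      s (finterp a) = finterp (fun i => s (a i));
    aut_rel : forall (r : rsym L) (a : 'I_(rarity r) -> U),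
      rinterp a <-> rinterp (fun i => s (a i)) }.

Definition elementary_on (L : language) (U : structure L) (B : set U)
    (f : U -> U) : Prop :=
  forall phi : formula L U, fvars phi `<=` B -> (holds id phi <-> holds f phi).

Definition strongly_homogeneous (K : Type) (L : language) (U : structure L) :
    Prop :=
  forall (B : set U) (f : U -> U), small K B -> elementary_on B f ->
    exists2 s : U -> U, automorphism s & {in B, s =1 f}.

Record monster (K : Type) (L : language) (T : set (sentence L))
    (U : structure L) : Prop := Monster {
  monster_card : small K [set: formula L nat];
  monster_model : model T U;
  monster_sat : saturated K U;
  monster_hom : strongly_homogeneous K U }.

(** * Keisler measures *)

(* Elements of M_x(U). Since U is a model, equivalence and inconsistency of
   L_U-formulas modulo the theory of U with parameters are tested in U. *)
Record keisler (R : realType) (L : language) (U : structure L) (X : finType)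
    (mu : formula L (X + U) -> R) : Prop := Keisler {
  keisler_ge0 : forall phi, 0 <= mu phi;
  keisler_true : mu FTrue = 1;
  keisler_equiv : forall phi psi,
    (forall a : X -> U, sat phi a <-> sat psi a) -> mu phi = mu psi;
  keisler_add : forall phi psi,
    (forall a : X -> U, ~ (sat phi a /\ sat psi a)) ->
    mu (FOr phi psi) = mu phi + mu psi }.

Notation borel S := (@g_sigma_algebraType S open).

Definition regular_measure (R : realType) (S : ptopologicalType)
    (P : set (borel S) -> \bar R) : Prop :=
  forall E : set (borel S), measurable E ->
    P E = ereal_inf [set P O | O in [set O : set S | open O /\ E `<=` O]] /\
    P E = ereal_sup [set P C | C in [set C : set S | compact C /\ C `<=` E]].

(* The regular Borel probability measure on S_x(B) identified with mu|_B; the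
   choice operator selects the unique element of the set. *)
Definition restriction (R : realType) (L : language) (U : structure L)
    (X : finType) (mu : formula L (X + U) -> R) (B : set U) :
    probability (borel (type_space X B)) R :=
  get [set P : pprobability (borel (type_space X B)) R |
    regular_measure P /\
    forall phi, formula_over B phi -> P [set q | type_set q phi] = (mu phi)%:E].

Definition invariant_over (R : realType) (L : language) (U : structure L)
    (X : finType) (A : set U) (mu : formula L (X + U) -> R) : Prop :=
  forall (Y : finType) (phi : formula L (X + Y)) (b b' : Y -> U),
    equiv_over A b b' ->
    mu (inst (no_params U phi) b) = mu (inst (no_params U phi) b').

(* F^phi_{mu,B}(q) = the common value of mu(phi(x,b)) for b realizing q *)
Definition fibre (R : realType) (L : language) (U : structure L)
    (X Y : finType) (mu : formula L (X + U) -> R) (B : set U)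
    (phi : formula L ((X + Y) + U)) (q : type_space Y B) : R :=
  xget 0 [set r | exists2 b : Y -> U, realizes b q & r = mu (inst phi b)].

Record borel_definable (R : realType) (L : language) (U : structure L)
    (X : finType) (A : set U) (mu : formula L (X + U) -> R) : Prop :=
  BorelDefinable {
    bdef_keisler : keisler mu;
    bdef_invariant : invariant_over A mu;
    bdef_borel : forall (Y : finType) (phi : formula L (X + Y)),
      measurable_fun [set: borel (type_space Y A)]
        (fibre mu (B := A) (no_params U phi)) }.

Record definable (R : realType) (L : language) (U : structure L)
    (X : finType) (A : set U) (mu : formula L (X + U) -> R) : Prop :=
  Definable {
    def_keisler : keisler mu;
    def_invariant : invariant_over A mu;
    def_continuous : forall (Y : finType) (phi : formula L (X + Y)),
      continuous (fibre mu (B := A) (no_params U phi)) }.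

(* mu ⊗ nu, for mu Borel definable over A. The value at phi does not depend on
   the small set B containing A over which phi is defined; we take the least
   one. *)
Definition morley (R : realType) (L : language) (U : structure L)
    (X Y : finType) (A : set U) (mu : formula L (X + U) -> R)
    (nu : formula L (Y + U) -> R) (phi : formula L ((X + Y) + U)) : R :=
  let B := A `|` params phi in
  \int[restriction nu B]_q fibre mu phi q.

(* phi((x,y),z) |-> phi(x,(y,z)) *)
Definition reassoc (L : language) (U : structure L) (X Y Z : Type)
    (phi : formula L (((X + Y) + Z) + U)) : formula L ((X + (Y + Z)) + U) :=
  frename (fun v => match v with
                    | inl (inl (inl x)) => inl (inl x)
                    | inl (inl (inr y)) => inl (inr (inl y))
                    | inl (inr z) => inl (inr (inr z))
                    | inr u => inr u
                    end) phi.

(* Main.v *)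
(* Everything is transported to spaces of types over [A]. If phi(x,y,c) has its
   parameters in a tuple c, then (mu ⊗ nu)(phi(x,y,c)) is the integral of the
   fibre function of phi(x;y,w) against the regular Borel measure nu_c on
   S_{yw}(A) with nu_c[psi(y,w)] = nu(psi(y,c)). This measure depends only on
   q = tp(c/A), so mu ⊗ nu is A-invariant, and both claims are statements about
   the family (nu_q): measurability of q |-> ∫ F dnu_q, and the disintegration
   P = ∫ nu_q d(lambda_c)(q) of the measure P attached to nu ⊗ lambda. They are
   checked on a pi-system generating a sigma-algebra for which F is measurable.
   If mu is definable, F is continuous, hence measurable for the sigma-algebra of
   the clopen sets, on which both hold by definition. If nu is definable, the
   open sets work: q |-> nu_q(O) is a supremum of continuous functions
   q |-> nu_q(D) over the clopen D in O, and integrals commute with directed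
   suprema of such functions because the measures are regular. *)
From HB Require Import structures.
Require Import Defs.
From mathcomp Require Import all_boot all_order all_algebra finmap.
From mathcomp Require Import all_classical all_reals all_analysis.
From mathcomp Require Import measurable_realfun giry lra.

Set Implicit Arguments.
Unset Strict Implicit.
Unset Printing Implicit Defensive.
Import Order.TTheory GRing.Theory Num.Theory.
Import numFieldNormedType.Exports.
Local Open Scope classical_set_scope.
Local Open Scope card_scope.
Local Open Scope ring_scope.

(** * Formulas, substitution and type spaces *)

Section Syntax.
Variable L : language.

Lemma teval_trename (M : structure L) (V W : Type) (g : V -> W) (v : W -> M)
  (t : term L V) : teval v (trename g t) = teval (v \o g) t.
Proof. by elim: t => //= f ts IH; congr finterp; apply/funext. Qed.

Lemma holds_frename (M : structure L) (V W : Type) (g : V -> W) (v : W -> M)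
  (phi : formula L V) : holds v (frename g phi) = holds (v \o g) phi.
Proof.
elim: phi W g v => //= {V} [V s t|V r ts|V p IH|V p IHp q IHq|V p IH] W g v.
- by rewrite !teval_trename.
- by congr rinterp; apply/funext => i; rewrite teval_trename.
- by rewrite IH.
- by rewrite IHp IHq.
- congr ex; apply/funext => a; rewrite IH; congr holds.
  by apply/funext => -[].
Qed.

Lemma trename_comp (V W V' : Type) (g : V -> W) (h : W -> V') (t : term L V) :
  trename h (trename g t) = trename (h \o g) t.
Proof. by elim: t => //= f ts IH; congr App; apply/funext. Qed.

Lemma frename_comp (V W V' : Type) (g : V -> W) (h : W -> V')
  (phi : formula L V) : frename h (frename g phi) = frename (h \o g) phi.
Proof.
elim: phi W V' g h => //= {V} [V s t|V r ts|V p IH|V p IHp q IHq|V p IH] W V' g h.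
- by rewrite !trename_comp.
- by congr FRel; apply/funext => i; rewrite trename_comp.
- by rewrite IH.
- by rewrite IHp IHq.
- by rewrite IH; congr (FEx (frename _ _)); apply/funext => -[].
Qed.

Lemma tvars_trename (V W : Type) (g : V -> W) (t : term L V) :
  tvars (trename g t) = g @` tvars t.
Proof.
elim: t => [v|f ts IH] /=; first by rewrite image_set1.
apply/seteqP; split=> [w [i]|_ [v [i iv]] <-].
  by rewrite IH => -[v iv <-]; exists v => //; exists i.
by exists i; rewrite IH; exists v.
Qed.

Lemma fvars_frename (V W : Type) (g : V -> W) (phi : formula L V) :
  fvars (frename g phi) = g @` fvars phi.
Proof.
elim: phi W g => //= {V} [V|V s t|V r ts|V p IHp q IHq|V p IH] W g.
- by rewrite image_set0.
- by rewrite !tvars_trename image_setU.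
- apply/seteqP; split=> [w [i]|_ [v [i iv]] <-].
    by rewrite tvars_trename => -[v iv <-]; exists v => //; exists i.
  by exists i; rewrite tvars_trename; exists v.
- by rewrite IHp IHq image_setU.
- apply/seteqP; split=> [w|_ [v pv] <-] /=; rewrite IH.
    by move=> [[v|//] pv [<-]]; exists v.
  by exists (Some v).
Qed.

Lemma finite_tvars (V : Type) (t : term L V) : finite_set (tvars t).
Proof.
elim: t => [v|f ts IH] /=; first exact: finite_set1.
rewrite (_ : [set v | _] = \bigcup_(i in [set: 'I_(farity f)]) tvars (ts i)).
  exact: bigcup_finite.
by apply/seteqP; split=> v [i]; [exists i|exists i].
Qed.

Lemma finite_fvars (V : Type) (phi : formula L V) : finite_set (fvars phi).
Proof.
elim: phi => //= {V} [V s t|V r ts|V p IHp q IHq|V p IH].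
- by rewrite finite_setU; split; exact: finite_tvars.
- rewrite (_ : [set v | _] = \bigcup_(i in [set: 'I_(rarity r)]) tvars (ts i)).
    by apply: bigcup_finite => // i _; exact: finite_tvars.
  by apply/seteqP; split=> v [i]; [exists i|exists i].
- by rewrite finite_setU.
- rewrite (_ : [set v | _] = Some @^-1` fvars p)//.
  by apply: finite_preimage => // x y _ _ [].
Qed.

Lemma trename_surj (V W : Type) (g : W -> V) (t : term L V) :
  tvars t `<=` range g -> exists t0, trename g t0 = t.
Proof.
elim: t => [v|f ts IH] /= H.
  by have [w _ <-] := H v erefl; exists (Var L w).
have /choice[ts0 ts0E] : forall i, exists t0, trename g t0 = ts i.
  by move=> i; apply: IH => v iv; apply: H; exists i.
by exists (App ts0) => /=; congr App; apply/funext.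
Qed.

(** This lets parameters be traded for variables, whether or not [g] is injective. Under a
    quantifier the bound variable [None] is its own preimage under [omap g], so the induction passes
    through [FEx]. *)
Lemma frename_surj (V W : Type) (g : W -> V) (phi : formula L V) :
  fvars phi `<=` range g -> exists phi0, frename g phi0 = phi.
Proof.
elim: phi W g => /= {V} [V|V s t|V r ts|V p IH|V p IHp q IHq|V p IH] W g H.
- by exists FTrue.
- have [|s0 <-] := @trename_surj _ _ g s; first by move=> v ?; apply: H; left.
  have [|t0 <-] := @trename_surj _ _ g t; first by move=> v ?; apply: H; right.
  by exists (FEq s0 t0).
- have /choice[ts0 ts0E] : forall i, exists t0, trename g t0 = ts i.
    by move=> i; apply: trename_surj => v iv; apply: H; exists i.
  by exists (FRel ts0) => /=; congr FRel; apply/funext.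
- by have [p0 <-] := IH _ _ H; exists (FNot p0).
- have [|p0 <-] := IHp _ g; first by move=> v ?; apply: H; left.
  have [|q0 <-] := IHq _ g; first by move=> v ?; apply: H; right.
  by exists (FAnd p0 q0).
- have [|p0 <-] := IH _ (omap g).
    move=> [v|]; last by exists None.
    by move=> /H[w _ <-]; exists (Some w).
  by exists (FEx p0).
Qed.

End Syntax.

Section Substitution.
Variables (L : language) (U : structure L).

(* A map [g : X1 -> X2 + U] replaces each variable of sort [X1] by a variable
   of sort [X2] or by a parameter; [inst] and [reassoc] are special cases. *)
Definition subst (X1 X2 : Type) (g : X1 -> X2 + U) (psi : formula L (X1 + U)) :
    formula L (X2 + U) :=
  frename (fun v => match v with inl x => g x | inr u => inr u end) psi.

Definition eval_at (X1 X2 : Type) (g : X1 -> X2 + U) (a : X2 -> U) (x : X1) : U :=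
  match g x with inl y => a y | inr u => u end.

Lemma sat_subst (X1 X2 : Type) (g : X1 -> X2 + U) psi (a : X2 -> U) :
  sat (subst g psi) a = sat psi (eval_at g a).
Proof.
rewrite /sat /subst holds_frename; congr holds.
by apply/funext => -[].
Qed.

Lemma subst_comp (X1 X2 X3 : Type) (g : X1 -> X2 + U) (h : X2 -> X3 + U) psi :
  subst h (subst g psi) =
  subst (fun x => match g x with inl y => h y | inr u => inr u end) psi.
Proof.
rewrite /subst frename_comp; congr frename.
by apply/funext => -[].
Qed.

Definition inst_at (X Y : Type) (b : Y -> U) (v : X + Y) : X + U :=
  match v with inl x => inl x | inr y => inr (b y) end.

Lemma inst_subst (X Y : Type) (phi : formula L ((X + Y) + U)) (b : Y -> U) :
  inst phi b = subst (inst_at b) phi.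
Proof.
by rewrite /inst /subst; congr frename; apply/funext => -[[]|].
Qed.

Lemma sat_inst (X Y : Type) (phi : formula L ((X + Y) + U)) (b : Y -> U)
  (a : X -> U) :
  sat (inst phi b) a =
  sat phi (fun v => match v with inl x => a x | inr y => b y end).
Proof.
by rewrite inst_subst sat_subst; congr sat; apply/funext => -[].
Qed.

Lemma params_subst (X1 X2 : Type) (g : X1 -> X2 + U) psi :
  params (subst g psi) `<=` params psi `|` [set u | exists x, g x = inr u].
Proof.
move=> u; rewrite /params /= /subst fvars_frename => -[[x|u'] H].
  by move=> gx; right; exists x.
by move=> [<-]; left.
Qed.

Lemma over_subst (X1 X2 : Type) (g : X1 -> X2 + U) (A B : set U) psi :
  A `<=` B -> (forall x u, g x = inr u -> B u) ->
  formula_over A psi -> formula_over B (subst g psi).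
Proof.
move=> AB gB Apsi u /params_subst[/Apsi/AB//|[x]]; exact: gB.
Qed.

Lemma over_no_params (X : Type) (A : set U) (phi : formula L X) :
  formula_over A (no_params U phi).
Proof. by move=> u; rewrite /params /= /no_params fvars_frename => -[]. Qed.

Lemma finite_params (X : Type) (phi : formula L (X + U)) :
  finite_set (params phi).
Proof.
have -> : params phi = inr @^-1` fvars phi by [].
by apply: finite_preimage; [move=> x y _ _ []|exact: finite_fvars].
Qed.

Lemma sat_or (X : Type) (phi psi : formula L (X + U)) a :
  sat (FOr phi psi) a <-> sat phi a \/ sat psi a.
Proof.
rewrite /sat /=; split=> [/not_andP[]/contrapT|]; [by left|by right|].
by move=> [?|?] [].
Qed.

Section Over.
Variables (X : Type) (B : set U).
Implicit Types phi psi : formula L (X + U).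

Lemma over_true : formula_over B (FTrue : formula L (X + U)).
Proof. by move=> u []. Qed.

Lemma over_not phi : formula_over B (FNot phi) <-> formula_over B phi.
Proof. by []. Qed.

Lemma over_and phi psi :
  formula_over B phi -> formula_over B psi -> formula_over B (FAnd phi psi).
Proof. by move=> Hp Hq u [/Hp|/Hq]. Qed.

Lemma over_or phi psi :
  formula_over B phi -> formula_over B psi -> formula_over B (FOr phi psi).
Proof. by move=> Hp Hq u [/Hp|/Hq]. Qed.

End Over.

(** A formula has finitely many free variables, so its parameters can be enumerated as a tuple [c],
    and [frename_surj] lifts the formula along the renaming that evaluates the new variables at
    [c]. *)
Lemma param_free (X : Type) (phi : formula L (X + U)) :
  exists n (c : 'I_n -> U) (phi0 : formula L (X + 'I_n)),
    range c `<=` params phi /\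
    phi = frename (fun v => match v with inl x => inl x | inr i => inr (c i) end)
      phi0.
Proof.
have /finite_seqP[s sE] := finite_params phi.
pose c (i : 'I_(size s)) := nth point s i.
pose g (v : X + 'I_(size s)) :=
  match v with inl x => inl x | inr i => inr (c i) end.
have [|phi0 phi0E] := @frename_surj L (X + U) (X + 'I_(size s)) g phi.
  move=> [x _|u up]; first by exists (inl x).
  have us : u \in s by have : params phi u by []; rewrite sE.
  have us' := us; rewrite -index_mem in us'.
  by exists (inr (Ordinal us')) => //=; rewrite /c /= nth_index.
exists (size s), c, phi0; split; last by rewrite -phi0E.
move=> _ [i _ <-].
by rewrite sE; exact: mem_nth.
Qed.

End Substitution.

(** * Type spaces are compact Hausdorff, with a base of clopen cylinders *)

Section TypeSpace.
Variables (L : language) (U : structure L) (X : Type) (B : set U).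
Implicit Types (phi psi : formula L (X + U)) (p q : type_space X B).

Definition cyl phi : set (type_space X B) := [set q | type_set q phi].

Lemma type_over p phi : type_set p phi -> formula_over B phi.
Proof. exact: (ct_over (type_setP p)). Qed.

Lemma type_satisfiable p phi psi : type_set p phi -> type_set p psi ->
  exists a, sat phi a /\ sat psi a.
Proof.
move=> pphi ppsi.
have [||a Ha] := ct_consistent (type_setP p) (s := [set phi; psi]).
- by rewrite finite_setU; split; exact: finite_set1.
- by move=> _ [] ->.
by exists a; split; apply: Ha; [left|right].
Qed.

Lemma type_imply p phi psi : type_set p phi -> formula_over B psi ->
  (forall a, sat phi a -> sat psi a) -> type_set p psi.
Proof.
move=> pphi Bpsi phipsi.
have [//|pN] := ct_complete (type_setP p) Bpsi.
by have [a [/phipsi]] := type_satisfiable pphi pN.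
Qed.

Lemma type_not p phi : formula_over B phi ->
  type_set p (FNot phi) <-> ~ type_set p phi.
Proof.
move=> Bphi; split=> [pN pphi|].
  by have [a []] := type_satisfiable pphi pN.
by have [] := ct_complete (type_setP p) Bphi.
Qed.

Lemma type_and p phi psi : formula_over B phi -> formula_over B psi ->
  type_set p (FAnd phi psi) <-> type_set p phi /\ type_set p psi.
Proof.
move=> Bphi Bpsi; split=> [pa|[pphi ppsi]].
  by split; apply: type_imply pa _ _ => // a [].
have [//|pN] := ct_complete (type_setP p) (over_and Bphi Bpsi).
have [||a Ha] := ct_consistent (type_setP p)
  (s := [set phi; psi] `|` [set FNot (FAnd phi psi)]).
- by rewrite !finite_setU; do !split; exact: finite_set1.
- by move=> _ [[]|] ->.
have : sat (FNot (FAnd phi psi)) a by apply: Ha; right.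
by case; split; apply: Ha; left; [left|right].
Qed.

Lemma type_or p phi psi : formula_over B phi -> formula_over B psi ->
  type_set p (FOr phi psi) <-> type_set p phi \/ type_set p psi.
Proof.
move=> Bphi Bpsi; rewrite /FOr type_not; last exact: over_and.
rewrite type_and// !type_not//; split=> [/not_andP[]/contrapT|]; [by left|by right|].
by move=> [?|?] [].
Qed.

Lemma type_ext p q : type_set p = type_set q -> p = q.
Proof.
case: p q => [p pP] [q qP] /= pq; rewrite pq in pP *.
by congr TypeSpace; exact: Prop_irrelevance.
Qed.

Lemma type_sub_eq p q : type_set p `<=` type_set q -> p = q.
Proof.
move=> pq; apply: type_ext; apply/seteqP; split=> // phi qphi.
have Bphi := type_over qphi.
have [//|/pq/type_not] := ct_complete (type_setP p) Bphi.
by move=> /(_ Bphi).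
Qed.

Lemma realizes_tp (b : X -> U) q : realizes b q -> q = tp B b.
Proof.
by move=> bq; apply: type_sub_eq => phi qphi; split; [exact: type_over qphi|exact: bq].
Qed.

Lemma realizes_type_set (b : X -> U) q phi : realizes b q ->
  type_set q phi <-> formula_over B phi /\ sat phi b.
Proof. by move=> /realizes_tp ->. Qed.

Lemma realizes_equiv (b b' : X -> U) q :
  realizes b q -> realizes b' q -> equiv_over B b b'.
Proof.
move=> bq b'q psi Bpsi; split=> H.
  by apply: b'q; apply/(realizes_type_set _ bq).
by apply: bq; apply/(realizes_type_set _ b'q).
Qed.

Lemma equiv_realizes (b b' : X -> U) q :
  equiv_over B b b' -> realizes b q -> realizes b' q.
Proof.
by move=> bb' bq phi qphi; apply/bb'; [exact: type_over qphi|exact: bq].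
Qed.

Lemma cyl_true : cyl FTrue = setT.
Proof.
apply/seteqP; split=> // q _ /=.
have [//|qN] := ct_complete (type_setP q) (@over_true L U X B).
by have [a [] []] := type_satisfiable qN qN.
Qed.

Lemma cyl_not phi : formula_over B phi -> cyl (FNot phi) = ~` cyl phi.
Proof. by move=> Bphi; apply/seteqP; split=> q /=; rewrite /cyl /= type_not. Qed.

Lemma cyl_and phi psi : formula_over B phi -> formula_over B psi ->
  cyl (FAnd phi psi) = cyl phi `&` cyl psi.
Proof. by move=> *; apply/seteqP; split=> q /=; rewrite /cyl /= type_and. Qed.

Lemma cyl_or phi psi : formula_over B phi -> formula_over B psi ->
  cyl (FOr phi psi) = cyl phi `|` cyl psi.
Proof. by move=> *; apply/seteqP; split=> q /=; rewrite /cyl /= type_or. Qed.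

Lemma cyl_sub phi psi : formula_over B phi -> formula_over B psi ->
  cyl phi `<=` cyl psi -> forall a, sat phi a -> sat psi a.
Proof. by move=> Bphi Bpsi sub a pa; have [] := sub (tp B a) (conj Bphi pa). Qed.

Lemma open_cyl phi : formula_over B phi -> open (cyl phi).
Proof.
move=> Bphi; exists [set cyl phi]; last by rewrite bigcup_set1.
move=> _ ->; exists [fset phi]%fset.
  by move=> psi; rewrite in_fset1 => /eqP ->; rewrite inE.
apply/seteqP; split=> q /=; first by apply; rewrite /= in_fset1.
by move=> ? ?; rewrite /= in_fset1 => /eqP ->.
Qed.

(** The cylinders are a base and not merely a subbase: a finite intersection of them is the cylinder
    of the conjunction. *)
Lemma nbhs_cyl p (N : set (type_space X B)) : nbhs p N ->
  exists2 phi, type_set p phi & cyl phi `<=` N.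
Proof.
rewrite nbhsE => -[V [[D sD <-] [E DE Ep]] VN].
have [F sF FE] := sD _ DE; rewrite -FE in Ep.
have [phi pphi phiF] : exists2 phi, type_set p phi &
    forall q psi, type_set q phi -> psi \in enum_fset F -> type_set q psi.
  have {Ep} : forall psi, psi \in enum_fset F -> type_set p psi by exact: Ep.
  elim: (enum_fset F) => [_|psi s IH sp].
    by exists FTrue => //; have : cyl FTrue p by rewrite cyl_true.
  have [|phi pphi phis] := IH; first by move=> x xs; apply: sp; rewrite inE xs orbT.
  have ppsi : type_set p psi by apply: sp; rewrite inE eqxx.
  have [Bphi Bpsi] := (type_over pphi, type_over ppsi).
  exists (FAnd psi phi); first exact/type_and.
  move=> q x /type_and[]// qpsi qphi; rewrite inE => /predU1P[->//|].
  exact: phis qphi.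
exists phi => // q qphi; apply: VN; exists E => //.
by have : E q by rewrite -FE => i iF; exact: (phiF q i qphi iF).
Qed.

Lemma compact_type_space : compact [set: type_space X B].
Proof.
rewrite compact_ultra => F FU _.
(* The limit of the ultrafilter [F] is the type of all formulas whose cylinder is in [F]. Finitely
   many such cylinders meet, which gives consistency; ultrafilters decide every cylinder, which
   gives completeness. *)
pose p := [set phi | formula_over B phi /\ F (cyl phi)].
have FS (s : set (formula L (X + U))) : finite_set s -> s `<=` p ->
    F (\bigcap_(phi in s) cyl phi).
  move=> /finite_fsetP[D ->] Dp; apply: filter_bigI => phi phiD.
  by have [] := Dp _ phiD.
have pP : complete_type B p.
  split=> [phi []//|s fs sp|phi Bphi].
    have [q qs] := filter_ex (FS _ fs sp).
    by have := ct_consistent (type_setP q) fs; apply.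
  have [FC|FC] := in_ultra_setVsetC (cyl phi) FU; [by left|right].
  by split=> //; rewrite cyl_not.
exists (TypeSpace pP); split=> // N /nbhs_cyl[phi [_ Fphi]] /filterS; exact.
Qed.

Lemma closed_cyl phi : formula_over B phi -> closed (cyl phi).
Proof.
by move=> Bphi; rewrite -openC -cyl_not//; apply: open_cyl.
Qed.

Lemma hausdorff_type_space : hausdorff_space (type_space X B).
Proof.
move=> p q pq; apply: type_sub_eq => phi pphi; have Bphi := type_over pphi.
apply: contrapT => /(type_not _ Bphi) qphi.
have [] := pq (cyl phi) (cyl (FNot phi)).
- by apply: open_nbhs_nbhs; split=> //; exact: open_cyl.
- by apply: open_nbhs_nbhs; split=> //; exact: open_cyl.
- by move=> r []; rewrite cyl_not.
Qed.

Lemma compact_sub_type_space (C : set (type_space X B)) : closed C -> compact C.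
Proof. by move=> cC; apply: subclosed_compact compact_type_space _. Qed.

End TypeSpace.
Arguments cyl {L U X} B phi.

(** Directedness collapses a finite subcover to a single member. *)
Lemma compact_directed (T : ptopologicalType) (I : choiceType) (J : set I)
    (D : I -> set T) (C : set T) :
  compact C -> J !=set0 -> (forall i, J i -> open (D i)) ->
  (forall i j, J i -> J j -> exists2 k, J k & D i `|` D j `<=` D k) ->
  C `<=` \bigcup_(i in J) D i -> exists2 i, J i & C `<=` D i.
Proof.
rewrite compact_cover => cC [i0 Ji0] oD dD CD.
have [F FJ CF] := cC _ _ _ oD CD.
have [i Ji Fi] : exists2 i, J i & forall j, j \in enum_fset F -> D j `<=` D i.
  have {}FJ j : j \in enum_fset F -> J j by move=> /FJ; rewrite inE.
  elim: (enum_fset F) FJ => [|j s IH] sJ; first by exists i0.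
  have [|i Ji si] := IH; first by move=> x xs; apply: sJ; rewrite inE xs orbT.
  have [|k Jk Dk] := dD i j Ji; first by apply: sJ; rewrite inE eqxx.
  exists k => // x; rewrite inE => /predU1P[->|xs] y xy; apply: Dk; first by right.
  by left; exact: si xs _ xy.
by exists i => // x /CF[j jF xj]; exact: Fi xj.
Qed.

Section Interpolation.
Variables (L : language) (U : structure L) (X : Type) (B : set U).
Implicit Types (O C : set (type_space X B)).

(** The cylinders inside [O] cover it and are directed by disjunction, so [compact_directed] finds
    one that contains [C]. *)
Lemma cyl_interpolation C O : compact C -> open O -> C `<=` O ->
  exists2 phi, formula_over B phi & C `<=` cyl B phi /\ cyl B phi `<=` O.
Proof.
move=> cC oO CO.
pose J := [set phi | formula_over B phi /\ cyl B phi `<=` O].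
have [||||phi [Bphi phiO] Cphi] := @compact_directed _ _ J (@cyl L U X B) C cC.
- exists (FNot FTrue); split; first exact: over_true.
  by rewrite cyl_not ?cyl_true ?setCT//; exact: over_true.
- by move=> phi [Bphi _]; exact: open_cyl.
- move=> phi psi [Bphi phiO] [Bpsi psiO]; exists (FOr phi psi); last by rewrite cyl_or.
  by split; [exact: over_or|rewrite cyl_or// subUset].
- move=> p /CO Op; have [phi pphi phiO] := nbhs_cyl (open_nbhs_nbhs (conj oO Op)).
  by exists phi => //; split=> //; exact: type_over pphi.
by exists phi.
Qed.

End Interpolation.

(** * Regular extension of a Keisler measure *)

Section Keisler.
Variables (R : realType) (L : language) (U : structure L) (X : finType).
Variable mu : formula L (X + U) -> R.
Hypothesis mu_keisler : keisler mu.
Implicit Types phi psi chi : formula L (X + U).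

Lemma keisler_not phi : mu (FNot phi) = 1 - mu phi.
Proof.
have <- : mu (FOr phi (FNot phi)) = 1.
  rewrite -(keisler_true mu_keisler); apply: keisler_equiv => // a; split=> // _.
  by apply/sat_or; exact: EM.
by rewrite (keisler_add mu_keisler) => [|a []//]; rewrite addrC addKr.
Qed.

Lemma keisler_le phi psi : (forall a, sat phi a -> sat psi a) -> mu phi <= mu psi.
Proof.
move=> phipsi.
have -> : mu psi = mu (FOr phi (FAnd psi (FNot phi))).
  apply: keisler_equiv => // a; rewrite sat_or; split=> [psia|[/phipsi//|[]//]].
  by have [?|?] := EM (sat phi a); [left|right].
rewrite (keisler_add mu_keisler) => [|a [? []]//].
by rewrite lerDl (keisler_ge0 mu_keisler).
Qed.

Lemma keisler_le1 phi : mu phi <= 1.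
Proof. by rewrite -(keisler_true mu_keisler); exact: keisler_le. Qed.

Lemma keisler_false : mu (FNot FTrue) = 0.
Proof. by rewrite keisler_not (keisler_true mu_keisler) subrr. Qed.

Lemma keisler_subadd phi psi chi :
  (forall a, sat phi a -> sat psi a \/ sat chi a) -> mu phi <= mu psi + mu chi.
Proof.
move=> H; apply: (@le_trans _ _ (mu (FOr psi (FAnd chi (FNot psi))))).
  apply: keisler_le => a /H[?|?]; rewrite sat_or; first by left.
  by have [?|?] := EM (sat psi a); [left|right].
rewrite (keisler_add mu_keisler) => [|a [? []]//].
by rewrite lerD2l; apply: keisler_le => a [].
Qed.

End Keisler.

Lemma keisler_subst (R : realType) (L : language) (U : structure L)
    (X1 X2 : finType) (g : X1 -> X2 + U) (mu : formula L (X2 + U) -> R) :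
  keisler mu -> keisler (fun psi => mu (subst g psi)).
Proof.
move=> Hmu; split=> [phi||phi psi eqv|phi psi disj].
- exact: keisler_ge0.
- exact: keisler_true.
- by apply: (keisler_equiv Hmu) => a; rewrite !sat_subst.
- by apply: (keisler_add Hmu) => a; rewrite !sat_subst.
Qed.

Section RegularExtension.
Variables (R : realType) (L : language) (U : structure L) (X : finType).
Variables (mu : formula L (X + U) -> R) (B : set U).
Hypothesis mu_keisler : keisler mu.
Local Notation S := (type_space X B).
Local Open Scope ereal_scope.

(** By interpolation, inner regularity forces the measure of an open set to be the supremum over its
    clopen subsets. [outer_content] then extends this to all sets as outer regularity demands, and
    is shown to be an outer measure for which open sets are Carathéodory measurable. *)
Definition inner_content (V : set S) : \bar R :=
  ereal_sup [set (mu phi)%:E | phi in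
    [set phi | formula_over B phi /\ cyl B phi `<=` V]].

Definition outer_content (E : set S) : \bar R :=
  ereal_inf [set inner_content V | V in [set V | open V /\ E `<=` V]].

Lemma inner_content_ge (V : set S) phi : formula_over B phi -> cyl B phi `<=` V ->
  (mu phi)%:E <= inner_content V.
Proof. by move=> Bphi phiV; apply: ereal_sup_ubound; exists phi. Qed.

Lemma inner_content_le (V : set S) x :
  (forall phi, formula_over B phi -> cyl B phi `<=` V -> (mu phi)%:E <= x) ->
  inner_content V <= x.
Proof. by move=> H; apply: ge_ereal_sup => _ [phi [Bphi phiV] <-]; exact: H. Qed.

Lemma inner_content_mono (V W : set S) : V `<=` W -> inner_content V <= inner_content W.
Proof.
move=> VW; apply: inner_content_le => phi Bphi phiV; apply: inner_content_ge => //.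
exact: subset_trans phiV VW.
Qed.

Lemma inner_content_ge0 (V : set S) : 0 <= inner_content V.
Proof.
rewrite -[0](congr1 EFin (keisler_false mu_keisler)).
apply: inner_content_ge.
  by apply/over_not; exact: over_true.
by rewrite cyl_not ?cyl_true ?setCT//; exact: over_true.
Qed.

Lemma inner_content_cyl phi : formula_over B phi ->
  inner_content (cyl B phi) = (mu phi)%:E.
Proof.
move=> Bphi; apply/eqP; rewrite eq_le inner_content_ge// andbT.
apply: inner_content_le => psi Bpsi psiphi; rewrite lee_fin.
by apply: keisler_le => //; exact: (cyl_sub Bpsi Bphi).
Qed.

Lemma inner_content_fin (V : set S) : inner_content V \is a fin_num.
Proof.
rewrite ge0_fin_numE ?inner_content_ge0//.
apply: (@le_lt_trans _ _ 1); last exact: ltey.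
by apply: inner_content_le => phi _ _; rewrite lee_fin keisler_le1.
Qed.

Lemma cyl_subadd phi (V W : set S) : formula_over B phi -> open V -> open W ->
  cyl B phi `<=` V `|` W -> (mu phi)%:E <= inner_content V + inner_content W.
Proof.
move=> Bphi oV oW phiVW.
(* A clopen [chi] is interpolated between the part of [phi] outside [W] and the open set [V]. Then
   [phi] is covered by [chi], inside [V], and by [phi] without [chi], inside [W]. *)
have cC : compact (cyl B phi `\` W).
  apply: compact_sub_type_space; apply: closedI; first exact: closed_cyl.
  exact: open_closedC.
have [|chi Bchi [Cchi chiV]] := cyl_interpolation cC oV.
  by move=> q [/phiVW[]].
apply: (@le_trans _ _ ((mu chi)%:E + (mu (FAnd phi (FNot chi)))%:E)).
  rewrite -EFinD lee_fin; apply: keisler_subadd => // a pa.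
  by have [?|?] := EM (sat chi a); [left|right].
apply: leeD; first exact: inner_content_ge.
apply: inner_content_ge; first exact: over_and.
rewrite cyl_and// cyl_not// => q [qphi qchi].
by apply: contrapT => qW; apply/qchi/Cchi.
Qed.

Lemma inner_content_bigsetU (F : nat -> set S) n : (forall k, open (F k)) ->
  inner_content (\big[setU/set0]_(k < n) F k) <= \sum_(k < n) inner_content (F k).
Proof.
move=> oF; elim: n => [|n IH].
  rewrite !big_ord0; apply: inner_content_le => phi Bphi phi0.
  rewrite -[leRHS](congr1 EFin (keisler_false mu_keisler)) lee_fin.
  apply: keisler_le => // a pa.
  by have := phi0 (tp B a); case; split.
rewrite !big_ord_recr/=; apply: (@le_trans _ _
  (inner_content (\big[setU/set0]_(k < n) F k) + inner_content (F n))).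
  apply: inner_content_le => phi Bphi; apply: cyl_subadd => //.
  by rewrite -bigcup_mkord; apply: bigcup_open.
exact: leeD.
Qed.

Lemma inner_content_bigcup (F : nat -> set S) : (forall k, open (F k)) ->
  inner_content (\bigcup_k F k) <= \sum_(k <oo) inner_content (F k).
Proof.
move=> oF; apply: inner_content_le => phi Bphi phiF.
(* A cylinder inside the countable union is compact, so it already lies in a finite partial
   union. *)
have [|||||n _ phin] := @compact_directed _ _ setT
  (fun n => \big[setU/set0]_(k < n) F k) (cyl B phi).
- by apply: compact_sub_type_space; exact: closed_cyl.
- by exists 0%N.
- by move=> n _; rewrite -bigcup_mkord; apply: bigcup_open.
- move=> m n _ _; exists (maxn m n) => //.
  by rewrite subUset; split; apply: subset_bigsetU; rewrite ?leq_maxl ?leq_maxr.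
- move=> q /phiF[k _ Fk]; exists k.+1 => //.
  by rewrite big_ord_recr/=; right.
apply: (le_trans (inner_content_ge Bphi phin)).
apply: (le_trans (inner_content_bigsetU _ oF)).
rewrite -(big_mkord xpredT (fun k => inner_content (F k))).
by apply: nneseries_lim_ge => k _ _; exact: inner_content_ge0.
Qed.

Lemma outer_content_open (V : set S) : open V -> outer_content V = inner_content V.
Proof.
move=> oV; apply/eqP; rewrite eq_le; apply/andP; split.
  by apply: ereal_inf_lbound; exists V => //; split.
by apply: le_ereal_inf_tmp => _ [W [oW VW] <-]; exact: inner_content_mono.
Qed.

Lemma outer_content_ge0 (E : set S) : 0 <= outer_content E.
Proof. by apply: le_ereal_inf_tmp => _ [W _ <-]; exact: inner_content_ge0. Qed.

Lemma outer_content_mono : {homo outer_content : E F / E `<=` F >-> E <= F}.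
Proof.
move=> E F EF; apply: ereal_inf_le_tmp => _ [V [oV FV] <-]; exists V => //.
by split=> //; exact: subset_trans FV.
Qed.

Lemma outer_content0 : outer_content set0 = 0.
Proof.
rewrite outer_content_open; last exact: open0.
have := inner_content_bigsetU (F := fun=> set0) 0 (fun=> open0).
rewrite !big_ord0 => H; apply/eqP; rewrite eq_le H.
exact: inner_content_ge0.
Qed.

Lemma outer_content_fin (E : set S) : outer_content E \is a fin_num.
Proof.
rewrite ge0_fin_numE ?outer_content_ge0//.
apply: (@le_lt_trans _ _ (inner_content setT)).
  by apply: ereal_inf_lbound; exists setT => //; split => //; exact: openT.
by rewrite -ge0_fin_numE ?inner_content_fin ?inner_content_ge0.
Qed.

Lemma outer_content_sigma_subadditive : sigma_subadditive outer_content.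
Proof.
move=> A; apply/lee_addgt0Pr => e e0.
apply: le_trans (epsilon_trick xpredT _ (ltW e0)); last first.
  by move=> n; exact: outer_content_ge0.
(* Open supersets of the [A n] are chosen with errors [e / 2 ^ n.+1], which sum to at most [e]. *)
have /choice[V VA] : forall n, exists V, [/\ open V, A n `<=` V &
    inner_content V <= outer_content (A n) + (e / (2 ^ n.+1)%:R)%:E].
  move=> n; have en : (0 < e / (2 ^ n.+1)%:R)%R by rewrite divr_gt0// ltr0n expn_gt0.
  have [_ [V [oV AV] <-] /ltW VA] := lb_ereal_inf_adherent en (outer_content_fin (A n)).
  by exists V.
apply: (@le_trans _ _ (inner_content (\bigcup_n V n))).
  apply: ereal_inf_lbound; exists (\bigcup_n V n) => //; split.
    by apply: bigcup_open => n _; have [] := VA n.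
  by apply: subset_bigcup => n _; have [] := VA n.
apply: le_trans (inner_content_bigcup _) _; first by move=> n; have [] := VA n.
apply: lee_nneseries => n; first by move=> *; exact: inner_content_ge0.
by have [] := VA n.
Qed.

(** For an open [W] containing [E], exhaust [W] in two stages: first by a cylinder [chi] inside both
    [W] and [V], then by a cylinder [psi] inside [W] and off [chi]. The two are disjoint, so the sum
    of their measures is that of one cylinder inside [W]. *)
Lemma open_caratheodory (V : set S) : open V ->
  forall E, outer_content (E `&` V) + outer_content (E `&` ~` V) <= outer_content E.
Proof.
move=> oV E; apply: le_ereal_inf_tmp => _ [W [oW EW] <-].
apply: (@le_trans _ _ (inner_content (W `&` V) + outer_content (E `&` ~` V))).
  apply: leeD => //; rewrite -outer_content_open; last exact: openI.
  by apply: outer_content_mono; exact: setSI.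
rewrite -leeBrDr ?outer_content_fin//.
apply: inner_content_le => chi Bchi chiWV.
rewrite leeBrDr ?outer_content_fin// addeC -leeBrDr//.
(* Since [chi] lies in [V], this set contains the part of [E] outside [V]; it is open because
   cylinders are closed. *)
have oWchi : open (W `&` ~` cyl B chi).
  by apply: openI => //; rewrite openC; exact: closed_cyl.
apply: (@le_trans _ _ (inner_content (W `&` ~` cyl B chi))).
  rewrite -outer_content_open//; apply: outer_content_mono.
  by apply: setISS => // q qV /chiWV[].
apply: inner_content_le => psi Bpsi psiW; rewrite leeBrDr// -EFinD.
rewrite -(keisler_add mu_keisler).
  apply: inner_content_ge; first exact: over_or.
  rewrite cyl_or// subUset; split; first by move=> q /psiW[].
  by move=> q /chiWV[].
move=> a [psia chia].
have [_] : (W `&` ~` cyl B chi) (tp B a) by apply: psiW; split.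
by apply; split.
Qed.

Lemma borel_caratheodory (E : set (borel S)) : measurable E ->
  caratheodory_measurable outer_content E.
Proof.
pose om : {outer_measure set S -> \bar R} := HB.pack outer_content
  (isOuterMeasure.Build R S outer_content outer_content0 outer_content_ge0
    outer_content_mono outer_content_sigma_subadditive).
have [c0 cC cU] : sigma_algebra setT (caratheodory_measurable om).
  split; first exact: caratheodory_measurable_set0.
    by move=> A cA; rewrite setTD; exact: caratheodory_measurable_setC.
  exact: caratheodory_measurable_bigcup.
apply: (@smallest_sub _ (sigma_algebra setT) _ _ (And3 c0 cC cU)) => V oV.
by apply: (@le_caratheodory_measurable _ _ om); exact: open_caratheodory.
Qed.

Lemma outer_content_sigma_additive :
  semi_sigma_additive (outer_content : set (borel S) -> \bar R).
Proof.
pose om : {outer_measure set S -> \bar R} := HB.pack outer_content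
  (isOuterMeasure.Build R S outer_content outer_content0 outer_content_ge0
    outer_content_mono outer_content_sigma_subadditive).
move=> F mF tF mUF.
apply: (@caratheodory_measure_sigma_additive _ _ om) => //.
  by move=> n; exact: borel_caratheodory.
exact: borel_caratheodory.
Qed.

Lemma outer_contentT : outer_content setT = 1.
Proof.
rewrite outer_content_open; last exact: openT.
by rewrite -(cyl_true X B) inner_content_cyl ?keisler_true//; exact: over_true.
Qed.

Lemma regular_extension : exists P : probability (borel S) R,
  regular_measure P /\ forall phi, formula_over B phi -> P (cyl B phi) = (mu phi)%:E.
Proof.
pose m := isMeasure.Build _ (borel S) R outer_content outer_content0
  outer_content_ge0 outer_content_sigma_additive.
pose M : {measure set (borel S) -> \bar R} := HB.pack outer_content m.
have [P PE] : exists P : probability (borel S) R, forall E, P E = outer_content E.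
  pose P : probability (borel S) R := HB.pack outer_content m
    (Measure_isProbability.Build _ _ _ M outer_contentT).
  by exists P.
exists P; split; last first.
  move=> phi Bphi; rewrite PE -inner_content_cyl// -outer_content_open//.
  exact: open_cyl.
have Pout (E : set S) :
    P E = ereal_inf [set P V | V in [set V : set S | open V /\ E `<=` V]].
  rewrite PE [LHS]/outer_content; congr ereal_inf; apply/seteqP.
  by split=> _ [V [oV EV] <-]; exists V => //; rewrite PE outer_content_open.
move=> E mE; split; first exact: Pout.
apply/eqP; rewrite eq_le; apply/andP; split; last first.
  apply: ge_ereal_sup => _ [C [cC CE] <-]; rewrite !PE.
  exact: outer_content_mono.
apply/lee_addgt0Pr => e e0.
have [_ [V [oV EV] <-]] := lb_ereal_inf_adherent e0 (outer_content_fin (~` E)).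
rewrite -/(outer_content _) -outer_content_open// -!PE => /ltW VE.
have mV : measurable (V : set (borel S)) by exact: sub_sigma_algebra.
apply: (@le_trans _ _ (P (~` V) + e%:E)); last first.
  apply: leeD => //; apply: ereal_sup_ubound; exists (~` V) => //; split.
    by apply: compact_sub_type_space; exact: open_closedC.
  by rewrite -[E in X in _ `<=` X]setCK; exact: subsetC.
move: VE; rewrite !probability_setC//.
rewrite -(fineK (fin_num_measure P _ mV)) -(fineK (fin_num_measure P _ mE)).
rewrite -?EFinB -?EFinD !lee_fin.
lra.
Qed.

End RegularExtension.

Lemma borel_open (S : ptopologicalType) (V : set S) :
  open V -> measurable (V : set (borel S)).
Proof. exact: sub_sigma_algebra. Qed.

Lemma borel_closed (S : ptopologicalType) (C : set S) :
  closed C -> measurable (C : set (borel S)).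
Proof.
move=> cC; rewrite -[C]setCK; apply: (@measurableC _ (borel S)).
by apply: borel_open; rewrite openC.
Qed.

Lemma measurable_cyl (L : language) (U : structure L) (X : Type) (B : set U)
    (phi : formula L (X + U)) : formula_over B phi ->
  measurable (cyl B phi : set (borel (type_space X B))).
Proof. by move=> Bphi; apply: borel_open; exact: open_cyl. Qed.

Section Restriction.
Variables (R : realType) (L : language) (U : structure L) (X : finType).
Variables (mu : formula L (X + U) -> R) (B : set U).
Hypothesis mu_keisler : keisler mu.
Local Open Scope ereal_scope.

Lemma restriction_spec : regular_measure (restriction mu B) /\
  forall phi, formula_over B phi -> restriction mu B (cyl B phi) = (mu phi)%:E.
Proof.
have [P PP] := regular_extension B mu_keisler.
exact: (@getPex (pprobability (borel (type_space X B)) R) [set P |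
  regular_measure P /\
  forall phi, formula_over B phi -> P (cyl B phi) = (mu phi)%:E]
  (ex_intro _ P PP)).
Qed.

Lemma restriction_cyl phi : formula_over B phi ->
  restriction mu B (cyl B phi) = (mu phi)%:E.
Proof. by case: restriction_spec => _; apply. Qed.

(** Every compact subset of [V] lies in a cylinder inside [V], so inner regularity determines the
    measure of an open set from [mu] alone. *)
Lemma restriction_open (V : set (type_space X B)) : open V ->
  restriction mu B V = inner_content mu V.
Proof.
move=> oV; have mV : measurable (V : set (borel (type_space X B))).
  exact: borel_open.
apply/eqP; rewrite eq_le; apply/andP; split.
  rewrite (restriction_spec.1 _ mV).2.
  apply: ge_ereal_sup => _ [C [cC CV] <-].
  have [phi Bphi [Cphi phiV]] := cyl_interpolation cC oV CV.
  apply: le_trans (inner_content_ge mu Bphi phiV).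
  rewrite -restriction_cyl//; apply: le_measure; rewrite ?inE //.
    apply: borel_closed; apply: compact_closed cC.
    exact: hausdorff_type_space.
  exact: measurable_cyl.
apply: inner_content_le => phi Bphi phiV; rewrite -restriction_cyl//.
by apply: le_measure; rewrite ?inE //; exact: measurable_cyl.
Qed.

End Restriction.

(** * Types and regular measures under a substitution *)

Section Push.
Variables (L : language) (U : structure L) (X1 X2 : Type).
Variables (g : X1 -> X2 + U) (B1 B2 : set U).
Hypotheses (B12 : B1 `<=` B2) (gB2 : forall x u, g x = inr u -> B2 u).

Lemma push_complete (q : type_space X2 B2) : complete_type B1
  [set psi : formula L (X1 + U) | formula_over B1 psi /\ type_set q (subst g psi)].
Proof.
split=> [psi []//|s fs sp|psi B1psi].
  have [||a Ha] := ct_consistent (type_setP q) (s := subst g @` s).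
  - exact: finite_image.
  - by move=> _ [psi /sp[_ ?] <-].
  exists (eval_at g a) => psi spsi; rewrite -sat_subst.
  by apply: Ha; exists psi.
have [qpsi|qpsi] := ct_complete (type_setP q) (over_subst B12 gB2 B1psi).
  by left.
by right.
Qed.

(** If [b] realizes [q], this is the type of [eval_at g b] over [B1]. It combines restriction to
    fewer parameters with the map on types dual to the substitution [g]. *)
Definition push (q : type_space X2 B2) : type_space X1 B1 :=
  TypeSpace (push_complete q).

Lemma push_preimage_cyl psi : formula_over B1 psi ->
  push @^-1` (cyl B1 psi) = cyl B2 (subst g psi).
Proof. by move=> B1psi; apply/seteqP; split=> q /= => [[]|]. Qed.

Lemma push_realizes (b : X2 -> U) q : realizes b q -> realizes (eval_at g b) (push q).
Proof. by move=> bq psi [_ /bq]; rewrite sat_subst. Qed.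

Lemma push_continuous : continuous push.
Proof.
move=> q N /nbhs_cyl[psi [B1psi qpsi] psiN].
apply: (@filterS _ _ _ (push @^-1` cyl B1 psi)); first by move=> x /psiN.
rewrite push_preimage_cyl//; apply: open_nbhs_nbhs; split=> //.
exact/open_cyl/(over_subst B12 gB2).
Qed.

End Push.

Lemma borel_measurable_continuous (S T : ptopologicalType) (f : S -> T) :
  continuous f -> measurable_fun [set: borel S] (f : borel S -> borel T).
Proof.
move=> /continuousP cf.
apply: (@measurability _ _ (borel S) (borel T) setT f open) => // _ [V oV <-].
by rewrite setTI; apply: borel_open; exact: cf.
Qed.

(** A probability measure is determined by its values on a generating pi-system, so [Q] is the image
    of [P] under [f]. *)
Lemma integral_image_pi (R : realType) d1 d2 (T1 : measurableType d1)
    (T2 : measurableType d2) (G : set (set T2)) (P : probability T1 R)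
    (Q : probability T2 R) (f : T1 -> T2) (h : T2 -> \bar R) :
  @measurable _ T2 = <<s G >> -> setI_closed G -> G setT ->
  measurable_fun setT f -> (forall V, G V -> Q V = P (f @^-1` V)) ->
  measurable_fun setT h -> (forall y, 0 <= h y)%E ->
  (\int[Q]_y h y = \int[P]_x h (f x))%E.
Proof.
move=> GE GI GT mf QP mh h0.
pose F : {mfun T1 >-> T2} := HB.pack f (isMeasurableFun.Build _ _ _ _ f mf).
rewrite -(ge0_integral_distribution F)//.
apply: eq_measure_integral => E mE _.
apply: (@measure_unique _ R _ G (fun=> setT)) => //.
  by apply/seteqP; split=> // x _; exists 0%N.
move=> _; apply: le_lt_trans (ltey 1); exact: (probability_le1 Q measurableT).
Qed.

Section Transfer.
Variables (R : realType) (L : language) (U : structure L) (X1 X2 : finType).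
Variables (g : X1 -> X2 + U) (B1 B2 : set U).
Hypotheses (B12 : B1 `<=` B2) (gB2 : forall x u, g x = inr u -> B2 u).
Variable mu : formula L (X2 + U) -> R.
Hypothesis mu_keisler : keisler mu.
Local Open Scope ereal_scope.
Local Notation mug := (fun psi => mu (subst g psi)).
Local Notation push := (push B12 gB2).

Lemma measurable_push : measurable_fun [set: borel (type_space X2 B2)]
  (push : _ -> borel (type_space X1 B1)).
Proof. exact: (borel_measurable_continuous (@push_continuous _ _ _ _ _ _ _ B12 gB2)). Qed.

Lemma restriction_push_open (V : set (type_space X1 B1)) : open V ->
  restriction mug B1 V = restriction mu B2 (push @^-1` V).
Proof.
move=> oV; have oV' : open (push @^-1` V).
  by move/continuousP: (push_continuous (B12 := B12) (gB2 := gB2)); apply.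
have mug_keisler := keisler_subst g mu_keisler.
rewrite !restriction_open//; apply/eqP; rewrite eq_le; apply/andP; split.
  apply: inner_content_le => psi B1psi psiV.
  apply: inner_content_ge; first exact: over_subst B1psi.
  by rewrite -(push_preimage_cyl B12 gB2)// => q /psiV.
apply: inner_content_le => phi B2phi phiV.
(* The cylinder of [phi] has a compact image under [push]. A cylinder over [B1] between this image
   and [V] pulls back to one that contains [phi], so formulas over [B2] give no larger supremum than
   formulas over [B1]. *)
have [||psi B1psi [phipsi psiV]] :=
    @cyl_interpolation _ _ _ _ (push @` cyl B2 phi) V _ oV.
- apply: continuous_compact; first exact/continuous_subspaceT/push_continuous.
  exact/compact_sub_type_space/closed_cyl.
- by move=> _ [q /phiV ? <-].
apply: le_trans (inner_content_ge mug B1psi psiV); rewrite lee_fin.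
apply: keisler_le => //; apply: (cyl_sub (B := B2)) => //; first exact: over_subst B1psi.
rewrite -(push_preimage_cyl B12 gB2)// => q qphi.
by apply: phipsi; exists q.
Qed.

Lemma integral_push (h : type_space X1 B1 -> \bar R) :
  measurable_fun [set: borel (type_space X1 B1)] (h : borel _ -> _) ->
  (forall q, 0 <= h q) ->
  \int[restriction mug B1]_q h q = \int[restriction mu B2]_q h (push q).
Proof.
move=> mh h0.
apply: (@integral_image_pi R _ _ (borel (type_space X2 B2))
  (borel (type_space X1 B1)) open (restriction mu B2) (restriction mug B1)
  push h) => //.
- by move=> V W; exact: openI.
- exact: openT.
- exact: measurable_push.
- exact: restriction_push_open.
Qed.

End Transfer.

(** * Integration against families of measures *)

Section KernelIntegral.
Variables (R : realType) (d1 d2 : measure_display).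
Variables (S1 : measurableType d1) (S2 : measurableType d2).
Variables (G : set (set S2)) (k : S1 -> probability S2 R).
Hypotheses (GI : setI_closed G) (GT : G setT) (Gm : G `<=` measurable).
Hypothesis mk : forall V, G V -> measurable_fun setT (fun q => k q V).
Local Open Scope ereal_scope.
Local Notation S2G := (g_sigma_algebraType G).

(** The hypotheses on [k] and [h] only concern [G], which may generate fewer sets than are
    measurable in [S2]. The kernel is therefore transported along the identity to the sigma-algebra
    generated by [G]. *)
Let measurable_incl : measurable_fun [set: S2] (id : S2 -> S2G).
Proof.
apply: (@measurability _ _ S2 S2G setT id G) => // _ [V GV <-].
by rewrite setTI; exact: Gm.
Qed.

Let incl : {mfun S2 >-> S2G} := HB.pack (id : S2 -> S2G)
  (isMeasurableFun.Build _ _ S2 S2G id measurable_incl).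

Let kG (q : S1) : giry S2G R := distribution (k q) incl.

(** The sets on which the kernel is measurable in [q] form a Dynkin system containing the pi-system
    [G]. *)
Let measurable_kG : measurable_fun setT kG.
Proof.
apply: measurable_giry_codensity => // E.
apply: (@dynkin_induction _ S2G G (fun E => measurable_fun setT (fun q => kG q E))) => //.
- exact: mk.
- move=> V mV IH; apply: (eq_measurable_fun (fun q => 1 - kG q V)).
    by move=> q _; rewrite -(probability_setC (distribution (k q) incl)).
  by apply: emeasurable_funB => //; exact: measurable_cst.
- move=> F mF tF IH.
  apply: (eq_measurable_fun (fun q => \sum_(0 <= i <oo) kG q (F i))).
    by move=> q _; rewrite measure_semi_bigcup//; exact: bigcup_measurable.
  exact: ge0_emeasurable_sum.
Qed.

Variable h : S2 -> \bar R.
Hypotheses (h0 : forall x, 0 <= h x) (mh : measurable_fun [set: S2G] (h : S2G -> _)).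

Let kG_int q : giry_int (kG q) h = \int[k q]_x h x.
Proof. exact: (ge0_integral_distribution incl). Qed.

Lemma measurable_kernel_integral : measurable_fun setT (fun q => \int[k q]_x h x).
Proof.
apply: (eq_measurable_fun (fun q => giry_int (kG q) h)).
  by move=> q _; rewrite kG_int.
exact: (measurableT_comp (measurable_giry_int mh h0) measurable_kG).
Qed.

(** The image of [P] and the Giry bind of [rho] with [kG] agree on [G], hence on the sigma-algebra
    it generates, and [h] is measurable for that sigma-algebra. *)
Lemma disintegration (rho : probability S1 R) (P : probability S2 R) :
  (forall V, G V -> P V = \int[rho]_q k q V) ->
  \int[P]_x h x = \int[rho]_q \int[k q]_x h x.
Proof.
move=> PG; rewrite -(ge0_integral_distribution incl)//.
transitivity (giry_int (giry_bind (rho : giry _ _) measurable_kG) h).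
  apply: eq_measure_integral => E mE _.
  apply: (@measure_unique _ R S2G G (fun=> setT)) => //.
  - by apply/seteqP; split=> // x _; exists 0%N.
  - move=> V GV; rewrite [LHS]PG//; symmetry.
    apply: (giry_int_map measurable_kG) => //.
    by apply: measurable_giry_ev; exact: sub_sigma_algebra.
  - move=> _; apply: le_lt_trans (ltey 1).
    exact: (probability_le1 P measurableT).
rewrite giry_int_bind//; apply: eq_integral => q _.
exact: kG_int.
Qed.

End KernelIntegral.

(** * Approximation of integrals by measures of superlevel sets *)

Section Layers.
Variables (R : realType).

(** The sum counts the naturals below both [n] and [y]: it is the smaller of [n] and the ceiling of
    [y]. *)
Lemma count_below (y : R) n : 0 <= y ->
  Num.min y n%:R <= \sum_(k < n) ((k%:R < y)%R)%:R :> R /\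
  \sum_(k < n) ((k%:R < y)%R)%:R <= y + 1 :> R.
Proof.
move=> y0; elim: n => [|n [IH1 IH2]].
  by rewrite big_ord0 ge_min lexx orbT; split=> //; lra.
rewrite big_ord_recr/=; have [ny|yn] := ltP n%:R y.
  split.
    rewrite (min_idPr (ltW ny)) in IH1.
    by rewrite ge_min -natr1 lerD2r IH1 orbT.
  have : \sum_(k < n) ((k%:R < y)%R)%:R <= n%:R :> R.
    rewrite -[n in leRHS](card_ord n) -sumr_const; apply: ler_sum => i _.
    by case: (_ < _).
  by rewrite /= => H; lra.
rewrite addr0; split=> //.
by rewrite (min_idPl yn) in IH1; rewrite ge_min IH1.
Qed.

Variables (d : measure_display) (S : measurableType d) (P : probability S R).
Variables (g : S -> R) (N : nat).
Hypotheses (mg : measurable_fun setT g) (g01 : forall x, 0 <= g x <= 1).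
Hypothesis N_gt0 : (0 < N)%N.
Local Open Scope ereal_scope.

(** By [count_below] at [N * g x], the average of the indicators of the first [N] layers exceeds [g]
    by at most [1/N] and is never below it. Integrals are thereby controlled by finitely many
    superlevel sets, which are open when [g] is lower semicontinuous. *)
Let layer (k : nat) := [set x | (k%:R / N%:R < g x)%R].

Let measurable_layer k : measurable (layer k).
Proof.
rewrite /layer -[X in measurable X]setTI.
exact: (measurable_fun_ltr (measurable_cst _) mg).
Qed.

Let integral_layers :
  \int[P]_x (N%:R^-1 * \sum_(k < N) \1_(layer k) x)%:E =
  (N%:R^-1)%:E * \sum_(k < N) P (layer k).
Proof.
under eq_integral do rewrite EFinM -sumEFin.
rewrite ge0_integralZl_EFin ?invr_ge0//; last 2 first.
- by move=> x _; apply: sume_ge0 => i _; rewrite lee_fin.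
- by apply: emeasurable_sum => i; apply/measurable_EFinP; exact: measurable_indic.
rewrite ge0_integral_sum//; last first.
  by move=> i; apply/measurable_EFinP; exact: measurable_indic.
congr (_ * _); apply: eq_bigr => i _.
by rewrite integral_indic// setIT.
Qed.

Let layersE x : (\sum_(k < N) \1_(layer k) x =
  \sum_(k < N) ((k%:R < N%:R * g x)%R)%:R :> R)%R.
Proof.
have N0 : (0 < N%:R :> R)%R by rewrite ltr0n.
apply: eq_bigr => k _; rewrite indicE -(ltr_pdivrMl _ _ N0) mulrC.
by congr ((nat_of_bool _)%:R); apply/idP/idP => [/set_mem|?]; last exact/mem_set.
Qed.

Let measurable_layers :
  measurable_fun setT (fun x => (N%:R^-1 * \sum_(k < N) \1_(layer k) x)%:E : \bar R).
Proof.
apply/measurable_EFinP; apply: measurable_funM => //.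
by apply: measurable_sum => i; exact: measurable_indic.
Qed.

Lemma integral_le_layers :
  \int[P]_x (g x)%:E <= (N%:R^-1)%:E * \sum_(k < N) P (layer k).
Proof.
rewrite -integral_layers; apply: ge0_le_integral => //.
- by move=> x _; rewrite lee_fin; case/andP: (g01 x).
- exact/measurable_EFinP.
move=> x _; rewrite lee_fin layersE ler_pdivlMl ?ltr0n//.
have /andP[g0 g1] := g01 x.
have [+ _] := count_below N (mulr_ge0 (ler0n R N) g0).
by rewrite (min_idPl _)// ler_piMr.
Qed.

Lemma layers_le_integral :
  (N%:R^-1)%:E * \sum_(k < N) P (layer k) <= \int[P]_x (g x)%:E + (N%:R^-1)%:E.
Proof.
rewrite -integral_layers.
have -> : (N%:R^-1)%:E = \int[P]_x (N%:R^-1)%:E :> \bar R.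
  rewrite integral_cst// -[LHS]mule1; congr (_ * _).
  exact/esym/(probability_setT P).
rewrite -ge0_integralD//; last 2 first.
- by move=> x _; rewrite lee_fin; case/andP: (g01 x).
- exact/measurable_EFinP.
apply: ge0_le_integral => //.
- by move=> x _; rewrite lee_fin mulr_ge0// sumr_ge0.
- by apply: emeasurable_funD => //; exact/measurable_EFinP.
move=> x _; rewrite -EFinD lee_fin layersE ler_pdivrMl ?ltr0n//.
have /andP[g0 g1] := g01 x.
have [_ +] := count_below N (mulr_ge0 (ler0n R N) g0).
by rewrite mulrDr divff// pnatr_eq0 -lt0n.
Qed.

End Layers.

Lemma borel_measurable_lsc (R : realType) (S : ptopologicalType) (f : S -> R) :
  (forall r, open [set x | r < f x]) ->
  measurable_fun [set: borel S] (f : borel S -> R).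
Proof.
move=> of_; apply: (@measurability _ _ (borel S) R setT f _ (RGenOInfty.measurableE R)).
move=> _ [_ [r ->] <-]; rewrite setTI; apply: borel_open.
by rewrite preimage_itvoy.
Qed.

(* Monotone convergence for a directed, possibly uncountable, family of lower
   semicontinuous functions: it needs the inner regularity of [P]. *)
Lemma integral_directed_sup (R : realType) (S : ptopologicalType) (I : choiceType)
    (P : probability (borel S) R) (J : set I) (F : I -> S -> R) (f : S -> R) (s : R) :
  hausdorff_space S -> (forall V : set S, open V ->
     P V = ereal_sup [set P C | C in [set C : set S | compact C /\ C `<=` V]]) ->
  J !=set0 -> (forall i r, J i -> open [set x | r < F i x]) ->
  (forall i j, J i -> J j ->
     exists2 k, J k & forall x, F i x <= F k x /\ F j x <= F k x) ->
  (forall i x, J i -> 0 <= F i x <= f x) -> (forall x, f x <= 1) ->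
  (forall x r, r < f x -> exists2 i, J i & r < F i x) ->
  (forall i, J i -> \int[P]_x (F i x)%:E <= s%:E)%E ->
  (\int[P]_x (f x)%:E <= s%:E)%E.
Proof.
move=> S_hausdorff P_inner J0 oF dF F0f f1 fF Fs.
have of_ r : open [set x | r < f x].
  rewrite (_ : [set x | _] = \bigcup_(i in J) [set x | r < F i x]).
    by apply: bigcup_open => i Ji; exact: oF.
  apply/seteqP; split=> [x /fF[i Ji rFi]|x [i Ji /= rFi]]; first by exists i.
  by apply: lt_le_trans rFi _; case/andP: (F0f i x Ji).
have [i0 Ji0] := J0.
have f01 x : 0 <= f x <= 1.
  by rewrite f1 andbT; have /andP[] := F0f i0 x Ji0; exact: le_trans.
have mf := borel_measurable_lsc of_.
have mF i (Ji : J i) := borel_measurable_lsc (fun r => oF i r Ji).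
apply/lee_addgt0Pr => e e0.
(* The error is at most [2/N]: one [1/N] comes from the layers of [F i], the other from the compact
   approximation of the layers of [f]. *)
have [n en] : exists n, 2 / e < n.+1%:R.
  by exists (Num.trunc (2 / e)); exact: truncnS_gt.
pose N := n.+1; have N0 : 0 < N%:R :> R by rewrite ltr0n.
have Ne : N%:R^-1 + N%:R^-1 <= e.
  have -> : N%:R^-1 + N%:R^-1 = 2 / N%:R :> R by lra.
  by rewrite ler_pdivrMr// mulrC -ler_pdivrMr//; exact: ltW en.
have iN0 : 0 < N%:R^-1 :> R by rewrite invr_gt0.
pose Lf (k : nat) := [set x | k%:R / N%:R < f x].
pose LF i (k : nat) := [set x | k%:R / N%:R < F i x].
have mLf k : measurable (Lf k : set (borel S)).
  by apply: borel_open; exact: of_.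
have mLF i k : J i -> measurable (LF i k : set (borel S)).
  by move=> Ji; apply: borel_open; exact: oF.
(* A compact set nearly filling the layer of [f] is covered by the directed open layers of the
   [F i], so one of these contains it. *)
have step k : exists2 i, J i & (P (Lf k) <= P (LF i k) + (N%:R^-1)%:E)%E.
  have fV : P (Lf k) \is a fin_num by exact: fin_num_measure.
  have oV : open (Lf k) by exact: of_.
  have fV' := fV; rewrite P_inner// in fV'.
  have [_ [C [cC CV] <-]] := ub_ereal_sup_adherent iN0 fV'.
  rewrite -P_inner// => VC.
  have [|||i Ji Ci] := @compact_directed S I J (LF ^~ k) C cC J0.
  - by move=> i Ji; exact: oF.
  - move=> i j Ji Jj; have [l Jl Hl] := dF i j Ji Jj; exists l => // x.
    by have [il jl] := Hl x; case=> /= /lt_le_trans; apply.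
  - by move=> x /CV /fF[i Ji ?]; exists i.
  exists i => //; rewrite -leeBlDr//; apply: le_trans (ltW VC) _.
  apply: le_measure; rewrite ?inE//; last exact: mLF.
  by apply: borel_closed; exact: compact_closed.
(* Directedness provides one index that serves all [N] layers at once. *)
have /(_ N)[i Ji Hi] : forall m, exists2 i, J i & forall k, (k < m)%N ->
    (P (Lf k) <= P (LF i k) + (N%:R^-1)%:E)%E.
  elim=> [|m [i Ji Hi]]; first by exists i0.
  have [j Jj Hj] := step m; have [l Jl Hl] := dF i j Ji Jj.
  have sub h : J h -> (forall x, F h x <= F l x) ->
      forall k, (P (LF h k) <= P (LF l k))%E.
    move=> Jh hl k; apply: le_measure; rewrite ?inE; [exact: mLF|exact: mLF|].
    by move=> x /= /lt_le_trans; apply.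
  exists l => // k; rewrite ltnS leq_eqVlt => /predU1P[->|km].
    by apply: le_trans Hj _; apply: leeD => //; apply: sub => // x; case: (Hl x).
  by apply: le_trans (Hi _ km) _; apply: leeD => //; apply: sub => // x; case: (Hl x).
apply: (le_trans (integral_le_layers P mf f01 (ltn0Sn n))).
apply: (@le_trans _ _ ((N%:R^-1)%:E *
  \sum_(k < N) (P (LF i k) + (N%:R^-1)%:E))%E).
  by rewrite lee_pmul2l ?lte_fin//; apply: lee_sum => k _; exact: Hi.
have F01 x : 0 <= F i x <= 1.
  by have /andP[-> /le_trans] := F0f i x Ji; apply.
have sumN : (\sum_(k < N) (N%:R^-1)%:E = 1 :> \bar R)%E.
  rewrite sumEFin sumr_const card_ord -(mulr_natl N%:R^-1) divff//.
  by rewrite gt_eqF.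
rewrite big_split/= sumN.
rewrite ge0_muleDr//; last by apply: sume_ge0.
rewrite mule1.
apply: (@le_trans _ _ (\int[P]_x (F i x)%:E + (N%:R^-1)%:E + (N%:R^-1)%:E)%E).
  by apply: leeD => //; exact: (layers_le_integral P (mF i Ji) F01 (ltn0Sn n)).
rewrite -addeA; apply: leeD; first exact: Fs.
by rewrite -EFinD lee_fin.
Qed.

Lemma bounded_integrable (R : realType) d (S : measurableType d)
    (P : probability S R) (f : S -> R) :
  measurable_fun setT f -> (forall x, 0 <= f x <= 1) ->
  P.-integrable setT (EFin \o f).
Proof.
move=> mf f01; apply: measurable_bounded_integrable => //.
  apply: le_lt_trans (ltey 1); exact: (probability_le1 P measurableT).
exists 1; split=> // M M1 x _ /=; have /andP[f0 f1] := f01 x.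
by rewrite ger0_norm// (le_trans f1)// ltW.
Qed.

(** The set from which [restriction] chooses only involves formulas over [B]; equal sets yield the
    same choice. *)
Lemma restriction_eq (R : realType) (L : language) (U : structure L) (X : finType)
    (B : set U) (m m' : formula L (X + U) -> R) :
  (forall psi, formula_over B psi -> m psi = m' psi) ->
  restriction m B = restriction m' B.
Proof.
move=> mm'; rewrite /restriction; congr get.
apply/seteqP; split=> P /= [Preg PE]; split=> // phi Bphi.
  by rewrite PE// mm'.
by rewrite PE// mm'.
Qed.

(** A superlevel set [r < f] is the countable union of the compact sets [r + n.+1%:R^-1 <= f].
    Interpolating a cylinder between each of these and the open set [r < f] exhibits it as a
    countable union of cylinders. *)
Lemma cyl_measurable_continuous (R : realType) (L : language) (U : structure L)
    (X : finType) (B : set U) (f : type_space X B -> R) : continuous f ->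
  measurable_fun
    [set: g_sigma_algebraType [set cyl B psi | psi in [set psi | formula_over B psi]]]
    (f : g_sigma_algebraType _ -> R).
Proof.
move=> cf0; have /continuousP cf := cf0; set G := [set cyl B psi | psi in _].
apply: (@measurability _ _ (g_sigma_algebraType G) R setT f _ (RGenOInfty.measurableE R)).
move=> _ [_ [r ->] <-]; rewrite setTI preimage_itvoy.
have oV : open [set x | r < f x].
  rewrite (_ : [set x | _] = f @^-1` [set y | r < y]); last by [].
  by apply: cf; exact: open_gt.
have /choice[psi psiP] : forall n, exists psi : formula L (X + U),
    [/\ formula_over B psi, [set x | r + n.+1%:R^-1 <= f x] `<=` cyl B psi
      & cyl B psi `<=` [set x | r < f x]].
  move=> n; have [||psi Bpsi [? ?]] :=
    @cyl_interpolation L U X B [set x | r + n.+1%:R^-1 <= f x] _ _ oV.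
  - apply: compact_sub_type_space.
    rewrite (_ : [set x | _] = f @^-1` [set y | r + n.+1%:R^-1 <= y]); last by [].
    apply: closed_comp; first by move=> x _; exact: cf0.
    exact: closed_ge.
  - by move=> x /=; apply: lt_le_trans; rewrite ltrDl invr_gt0.
  by exists psi.
rewrite (_ : [set x | r < f x] = \bigcup_n cyl B (psi n)).
  apply: bigcup_measurable => n _; apply: sub_sigma_algebra.
  by exists (psi n) => //; have [] := psiP n.
apply/seteqP; split=> [x /= rf|x [n _]]; last by have [_ _] := psiP n; apply.
have [n nf] : exists n, (f x - r)^-1 < n.+1%:R.
  by exists (Num.trunc (f x - r)^-1); exact: truncnS_gt.
exists n => //; have [_ + _] := psiP n; apply => /=.
rewrite addrC -lerBrDr -[leRHS]invrK lef_pV2 ?posrE ?invr_gt0 ?subr_gt0//.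
exact: ltW.
Qed.

(** * Morley products *)

Lemma card_le_setU1 (S : pointedType) (A : set S) (x : S) :
  infinite_set A -> A `|` [set x] #<= A.
Proof.
move=> Ainf; have [xA|xA] := pselect (A x).
  by apply: subset_card_le => y [//|->].
have /infiniteP/pcard_leP[g] := Ainf.
have gA n : A (g n) by exact: funS.
have gI : injective g by move=> m n; apply: inj; rewrite inE.
(* Hilbert's hotel: [h] shifts the sequence [g] by one, sends [x] to the vacated [g 0] and fixes all
   other elements of [A]. *)
pose h y := if pselect (exists n, y = g n) is left H then g (projT1 (cid H)).+1
  else if pselect (A y) then y else g 0%N.
have hg n : h (g n) = g n.+1.
  by rewrite /h; case: pselect => [H|[]]; [case: cid => m /= /gI <-|exists n].
have hx : h x = g 0%N.
  rewrite /h; case: pselect => [[n xg]|_]; first by case: xA; rewrite xg.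
  by case: pselect.
have hA y : A y -> (forall n, y <> g n) -> h y = y.
  move=> Ay yg; rewrite /h; case: pselect => [[n /yg]//|_].
  by case: pselect.
have cases y : (A `|` [set x]) y ->
    [\/ y = x, exists n, y = g n | A y /\ forall n, y <> g n].
  case=> [Ay|->]; last by constructor 1.
  have [?|/forallNP ?] := pselect (exists n, y = g n); first by constructor 2.
  by constructor 3.
apply/pcard_leP/injfunPex; exists h.
  by move=> y /cases[->|[n ->]|[Ay yg]]; rewrite ?hx ?hg ?hA.
move=> y z; rewrite !inE => /cases[->|[n ->]|[Ay yg]] /cases[->|[m ->]|[Az zg]];
  rewrite ?hx ?hg ?hA//.
- by move=> /gI.
- by move=> /esym/zg.
- by move=> /gI.
- by move=> /gI [->].
- by move=> /esym/zg.
- by move=> /yg.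
- by move=> /yg.
Qed.

Lemma small_setU_finite (K : Type) (S : pointedType) (A F : set S) :
  infinite_set [set: K] -> small K A -> finite_set F -> small K (A `|` F).
Proof.
move=> Kinf + /finite_seqP[s ->]; rewrite /small /card_lt.
(* If [A] is finite, so is the union, while [K] is infinite. If [A] is infinite, finitely many new
   elements do not raise its cardinality. *)
have [Afin _|Ainf] := pselect (finite_set A).
  have AFfin : finite_set (A `|` [set` s]) by rewrite finite_setU.
  apply/andP; split; last by apply/negP => /card_le_finite/(_ AFfin).
  have [n /card_eqPle[AFn _]] := AFfin.
  apply: card_le_trans AFn _; apply: card_le_trans _ ((infiniteP _).1 Kinf).
  exact: card_leT.
have AF : A `|` [set` s] #<= A.
  elim: s => [|x s IH]; first by apply: subset_card_le => y [].
  have -> : A `|` [set` x :: s] = (A `|` [set` s]) `|` [set x].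
    apply/seteqP; split=> y /=; rewrite inE.
      by move=> [?|/predU1P[->|?]]; [left; left|right|left; right].
    by move=> [[?|?]|->]; [left|right; apply/orP; right|right; rewrite eqxx].
  apply: card_le_trans IH; apply: card_le_setU1.
  by apply: sub_infinite_set Ainf => y; left.
move=> /andP[AK KA]; apply/andP; split; first exact: card_le_trans AF AK.
by apply: contra KA => /card_le_trans; apply.
Qed.

Lemma monster_infinite (K : Type) (L : language) (T : set (sentence L))
  (U : structure L) : monster K T U -> infinite_set [set: K].
Proof.
move=> /monster_card/andP[FK _]; apply/infiniteP; apply: card_le_trans FK.
(* The equations of a variable with itself are countably many distinct formulas, and the formulas
   embed into [K]. *)
apply/pcard_injP; exists (fun n => FEq (Var L n) (Var L n)).
by move=> m n _ _ [].
Qed.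

(** * Fibre functions and Morley products under a substitution *)

Section Lift.
Variables (L : language) (U : structure L).

Definition lift_at (X V Y : Type) (g : V -> Y + U) (v : X + V) : (X + Y) + U :=
  match v with
  | inl x => inl (inl x)
  | inr w => match g w with inl y => inl (inr y) | inr u => inr u end
  end.

Lemma inst_lift (X V Y : Type) (g : V -> Y + U) (phi : formula L ((X + V) + U))
  (b : Y -> U) : inst (subst (lift_at g) phi) b = inst phi (eval_at g b).
Proof.
rewrite !inst_subst subst_comp; congr subst; apply/funext => -[x//|w] /=.
by rewrite /eval_at; case: (g w).
Qed.

Lemma subst_id (X : Type) (phi : formula L (X + U)) : subst inl phi = phi.
Proof.
have [phi0 phi0E] := @frename_surj L (X + U) (X + U) id phi
  (fun v _ => ex_intro2 _ _ v I erefl).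
rewrite -phi0E /subst frename_comp; congr frename.
by apply/funext => -[].
Qed.

(** Invariance and definability are assumed for formulas without parameters only. Moving the
    parameters into extra variables next to [Y] reduces a general formula to that case. *)
Lemma name_params (X Y : Type) (phi : formula L ((X + Y) + U)) :
  exists n (g : Y + 'I_n -> Y + U) (phi0 : formula L (X + (Y + 'I_n))),
    (forall v u, g v = inr u -> params phi u) /\
    phi = subst (lift_at g) (no_params U phi0).
Proof.
have [n [c [phi0 [cP phiE]]]] := param_free phi.
exists n, (fun v => match v with inl y => inl y | inr i => inr (c i) end).
exists (frename (fun v => match v with inl (inl x) => inl x
  | inl (inr y) => inr (inl y) | inr i => inr (inr i) end) phi0).
split=> [[y|i] u //= [<-]|]; first by apply: cP; exists i.
rewrite phiE /no_params /subst !frename_comp; congr frename.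
by apply/funext => -[[]|].
Qed.

Lemma over_reassoc (X Y V : Type) (B : set U) (phi : formula L (((X + Y) + V) + U)) :
  formula_over B phi -> formula_over B (reassoc phi).
Proof.
move=> Bphi u; rewrite /params /= /reassoc fvars_frename.
by move=> [[[[x|y]|z]|u'] //= up [<-]]; exact: Bphi.
Qed.

Lemma reassoc_subst (X Y V Z : Type) (g : V -> Z + U)
    (phi : formula L (((X + Y) + V) + U)) :
  reassoc (subst (lift_at g) phi) = subst (lift_at (lift_at g)) (reassoc phi).
Proof.
rewrite /reassoc /subst !frename_comp; congr frename.
by apply/funext => -[[[x|y]|v]|u] //=; case: (g v).
Qed.

Lemma inst_reassoc (X Y V : Type) (phi : formula L (((X + Y) + V) + U)) (b : V -> U) :
  inst phi b = subst (lift_at (inst_at b)) (reassoc phi).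
Proof.
rewrite /inst /reassoc /subst frename_comp; congr frename.
by apply/funext => -[[[x|y]|v]|u].
Qed.

End Lift.

Section Invariance.
Variables (R : realType) (L : language) (U : structure L) (X Y : finType).
Variables (mu : formula L (X + U) -> R) (A B : set U).
Hypotheses (mu_invariant : invariant_over A mu) (AB : A `<=` B).

(** If [c] lists the parameters of [phi], then equivalence of [b] and [b'] over [B] makes [(b, c)]
    and [(b', c)] equivalent over [A], where the assumed invariance applies. *)
Lemma inst_equiv (phi : formula L ((X + Y) + U)) (b b' : Y -> U) :
  formula_over B phi -> equiv_over B b b' -> mu (inst phi b) = mu (inst phi b').
Proof.
move=> Bphi bb'; have [n [g [phi0 [gphi ->]]]] := name_params phi.
rewrite !inst_lift; apply: mu_invariant => psi Apsi.
rewrite -!sat_subst; apply: bb'; apply: over_subst Apsi => // v u /gphi.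
exact: Bphi.
Qed.

Lemma fibreE (phi : formula L ((X + Y) + U)) (b : Y -> U) q :
  formula_over B phi -> realizes b q -> fibre mu (B := B) phi q = mu (inst phi b).
Proof.
move=> Bphi bq; apply: xget_unique; first by exists b.
move=> _ [b' b'q ->]; apply: inst_equiv => //.
exact: realizes_equiv b'q bq.
Qed.

End Invariance.

Section FibreBounds.
Variables (R : realType) (L : language) (U : structure L) (X Y : finType).
Variables (mu : formula L (X + U) -> R) (B : set U).
Hypothesis mu_keisler : keisler mu.

Lemma fibre_ge0 (phi : formula L ((X + Y) + U)) (q : type_space Y B) :
  0 <= fibre mu phi q.
Proof.
by rewrite /fibre; case: xgetP => [r _ [b _ ->]|//]; exact: keisler_ge0.
Qed.

Lemma fibre_le1 (phi : formula L ((X + Y) + U)) (q : type_space Y B) :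
  fibre mu phi q <= 1.
Proof.
by rewrite /fibre; case: xgetP => [r _ [b _ ->]|//]; exact: keisler_le1.
Qed.

End FibreBounds.

Section Monster.
Variables (R : realType) (L : language) (T : set (sentence L)) (K : Type).
Variables (U : structure L) (A : set U).
Hypotheses (U_monster : monster K T U) (A_small : small K A).

Lemma small_params (X : finType) (phi : formula L (X + U)) (B : set U) :
  small K B -> small K (B `|` params phi).
Proof.
move=> smB; apply: small_setU_finite => //; last exact: finite_params.
exact: monster_infinite U_monster.
Qed.

Lemma realized (X : finType) (B : set U) (q : type_space X B) :
  small K B -> exists b, realizes b q.
Proof. exact: (monster_sat U_monster). Qed.

Section Fibre.
Variables (X Y V : finType) (mu : formula L (X + U) -> R).
Hypothesis mu_invariant : invariant_over A mu.
Variables (g : V -> Y + U) (B1 B2 : set U).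
Hypotheses (AB1 : A `<=` B1) (B12 : B1 `<=` B2).
Hypothesis gB2 : forall v u, g v = inr u -> B2 u.
Hypothesis B2_small : small K B2.

(** Saturation provides a realization [b] of [q]; both sides are the measure of [phi] instantiated
    at [eval_at g b]. *)
Lemma fibre_push (phi : formula L ((X + V) + U)) (q : type_space Y B2) :
  formula_over B1 phi ->
  fibre mu (subst (lift_at g) phi) q = fibre mu phi (push B12 gB2 q).
Proof.
move=> B1phi; have [b bq] := realized q B2_small.
rewrite (fibreE mu_invariant (subset_trans AB1 B12) _ bq); last first.
  apply: over_subst B1phi => // -[x//|v] u /=.
  by case gv : (g v) => [//|u'] [<-]; exact: gB2 gv.
have bq' : realizes (eval_at g b) (push B12 gB2 q) by exact: push_realizes.
by rewrite inst_lift (fibreE mu_invariant AB1 B1phi bq').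
Qed.

End Fibre.

(** Naming the parameters factors the fibre function through the continuous [push] to types over
    [A], followed by a fibre function that is Borel by hypothesis. *)
Lemma measurable_fibre (X Y : finType) (mu : formula L (X + U) -> R)
    (B : set U) (phi : formula L ((X + Y) + U)) :
  borel_definable A mu -> A `<=` B -> small K B -> formula_over B phi ->
  measurable_fun [set: borel (type_space Y B)] (fibre mu (B := B) phi).
Proof.
move=> mu_def AB B_small Bphi.
have [n [g [phi0 [gphi ->]]]] := name_params phi.
have gB v u : g v = inr u -> B u by move=> /gphi /Bphi.
have -> : fibre mu (B := B) (subst (lift_at g) (no_params U phi0)) =
    fibre mu (B := A) (no_params U phi0) \o push AB gB.
  apply/funext => q; apply: fibre_push => //; first exact: bdef_invariant.
  exact: over_no_params.
apply: (@measurableT_comp _ _ _ _ (borel (type_space _ A))).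
  exact: bdef_borel.
exact: measurable_push.
Qed.

Lemma continuous_fibre (X Y : finType) (mu : formula L (X + U) -> R)
    (phi : formula L ((X + Y) + U)) :
  definable A mu -> formula_over A phi ->
  continuous (fibre mu (B := A) phi : type_space Y A -> R).
Proof.
move=> mu_def Aphi; have [n [g [phi0 [gphi ->]]]] := name_params phi.
have gA v u : g v = inr u -> A u by move=> /gphi /Aphi.
have -> : fibre mu (B := A) (subst (lift_at g) (no_params U phi0)) =
    fibre mu (B := A) (no_params U phi0) \o push (@subset_refl _ A) gA.
  apply/funext => q; apply: fibre_push => //; first exact: def_invariant.
  exact: over_no_params.
move=> q; apply: continuous_comp; first exact: push_continuous.
exact: def_continuous.
Qed.

Section Morley.
Variables (X Y : finType) (mu : formula L (X + U) -> R).
Variable nu : formula L (Y + U) -> R.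
Hypotheses (mu_def : borel_definable A mu) (nu_keisler : keisler nu).

Lemma integral_fibre_push (V : finType) (g : V -> Y + U) (B1 B2 : set U)
    (AB1 : A `<=` B1) (B12 : B1 `<=` B2) (phi : formula L ((X + V) + U)) :
  (forall v u, g v = inr u -> B2 u) -> small K B2 -> formula_over B1 phi ->
  \int[restriction (fun psi => nu (subst g psi)) B1]_q fibre mu phi q =
  \int[restriction nu B2]_q fibre mu (subst (lift_at g) phi) q.
Proof.
move=> gB2 B2_small B1phi; rewrite /Rintegral.
rewrite (integral_push B12 gB2 nu_keisler (h := EFin \o _)).
- congr fine; apply: eq_integral => q _ /=.
  by rewrite (fibre_push (bdef_invariant mu_def) AB1 B12 gB2).
- apply/measurable_EFinP; apply: measurable_fibre => //.
  move: B2_small; rewrite /small /card_lt => /andP[B2K KB2].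
  apply/andP; split; first exact: card_le_trans (subset_card_le B12) B2K.
  by apply: contra KB2 => /card_le_trans; apply; exact: subset_card_le.
- by move=> q /=; rewrite lee_fin; apply: fibre_ge0; exact: bdef_keisler mu_def.
Qed.

(** This is the independence of the choice of [B]: the trivial substitution [inl] compares [B] with
    the least admissible set. *)
Lemma morleyE (B : set U) (phi : formula L ((X + Y) + U)) :
  A `<=` B -> small K B -> formula_over B phi ->
  morley A mu nu phi = \int[restriction nu B]_q fibre mu phi q.
Proof.
move=> AB B_small Bphi; rewrite /morley.
have AphiB : A `|` params phi `<=` B by rewrite subUset.
have := @integral_fibre_push Y inl (A `|` params phi) B _ AphiB phi.
rewrite (_ : subst (lift_at inl) phi = phi); last first.
  rewrite -[RHS]subst_id; congr subst.
  by apply/funext => -[].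
under eq_fun do rewrite subst_id.
apply => //.
by move=> u; right.
Qed.

(** Parameters enter only through [g], and are absorbed into the measure. All Morley products thus
    become integrals over types over the fixed set [A]. *)
Lemma morley_subst (V : finType) (g : V -> Y + U)
    (phi : formula L ((X + V) + U)) : formula_over A phi ->
  morley A mu nu (subst (lift_at g) phi) =
  \int[restriction (fun psi => nu (subst g psi)) A]_q fibre mu phi q.
Proof.
move=> Aphi; set psi := subst _ _.
pose B := (A `|` params psi) `|` [set u | exists v, g v = inr u].
have AB : A `<=` B by move=> u Au; left; left.
have B_small : small K B.
  apply: small_setU_finite; first exact: monster_infinite U_monster.
    exact: small_params.
  rewrite (_ : [set u | _] = inr @^-1` (range g)).
    by apply: finite_preimage; [move=> ? ? _ _ []|exact: finite_image].
  by apply/seteqP; split=> u [v]; [exists v|exists v].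
rewrite (@morleyE B)//; last by move=> u ?; left; right.
symmetry; apply: integral_fibre_push => // v u gv.
by right; exists v.
Qed.

End Morley.

End Monster.

(** * The Keisler measure of the product, and the fibre measures *)

Section FibreMeasures.
Variables (R : realType) (L : language) (T : set (sentence L)) (K : Type).
Variables (U : structure L) (A : set U).
Hypotheses (U_monster : monster K T U) (A_small : small K A).

Section MorleyKeisler.
Variables (X Y : finType) (mu : formula L (X + U) -> R).
Variable nu : formula L (Y + U) -> R.
Hypotheses (mu_def : borel_definable A mu) (nu_keisler : keisler nu).

Let morleyE := morleyE U_monster mu_def nu_keisler.

(** Formulas to be compared are put over one small set, where the integrands are compared type by
    type through realizations; additivity is then linearity of the integral. *)
Lemma keisler_morley : keisler (morley A mu nu).
Proof.
have mu_keisler := bdef_keisler mu_def.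
have mu_inv := bdef_invariant mu_def.
split=> [phi||phi psi eqv|phi psi disj].
- by rewrite /morley; apply: Rintegral_ge0 => q _; exact: (fibre_ge0 mu_keisler).
- have Atrue : formula_over A (FTrue : formula L ((X + Y) + U)) by exact: over_true.
  rewrite (morleyE (@subset_refl _ A) A_small Atrue).
  transitivity (\int[restriction nu A]_q (1 : R)); last first.
    rewrite Rintegral_cst// mul1r.
    exact: (congr1 fine (probability_setT (restriction nu A))).
  apply: eq_Rintegral => q _; have [b bq] := realized U_monster q A_small.
  rewrite (fibreE mu_inv (@subset_refl _ A) Atrue bq).
  exact: keisler_true.
- pose B := (A `|` params phi) `|` params psi.
  have B_small : small K B by do 2 apply: (small_params U_monster).
  have AB : A `<=` B by move=> u ?; left; left.
  have Bphi : formula_over B phi by move=> u ?; left; right.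
  have Bpsi : formula_over B psi by move=> u ?; right.
  rewrite !(@morleyE B)//; apply: eq_Rintegral => q _.
  have [b bq] := realized U_monster q B_small.
  rewrite !(fibreE mu_inv AB _ bq)//; apply: (keisler_equiv mu_keisler) => a.
  by rewrite !sat_inst.
- pose B := (A `|` params phi) `|` params psi.
  have B_small : small K B by do 2 apply: (small_params U_monster).
  have AB : A `<=` B by move=> u ?; left; left.
  have Bphi : formula_over B phi by move=> u ?; left; right.
  have Bpsi : formula_over B psi by move=> u ?; right.
  have Bor := over_or Bphi Bpsi.
  have int chi : formula_over B chi ->
      (restriction nu B).-integrable setT (EFin \o (fibre mu (B := B) chi)).
    move=> Bchi; apply: bounded_integrable.
      exact: (measurable_fibre U_monster mu_def AB B_small Bchi).
    by move=> q; rewrite (fibre_ge0 mu_keisler) (fibre_le1 mu_keisler).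
  rewrite !(@morleyE B)// -RintegralD//; [|exact: int|exact: int].
  apply: eq_Rintegral => q _.
  have [b bq] := realized U_monster q B_small.
  rewrite !(fibreE mu_inv AB _ bq)// -(keisler_add mu_keisler)//.
  by move=> a; rewrite !sat_inst; exact: disj.
Qed.

End MorleyKeisler.

Section FibreMeasure.
Variables (Y V : finType) (nu : formula L (Y + U) -> R).
Hypotheses (nu_keisler : keisler nu) (nu_invariant : invariant_over A nu).

(** This is the regular measure of [nu] in [y] with the variables [V] fixed at a realization of [q].
    The realization is picked by choice, and [fibre_measureE] uses invariance to replace it by any
    other. *)
Definition fibre_measure (q : type_space V A) :
    probability (borel (type_space (Y + V)%type A)) R :=
  restriction (fun psi => nu (subst (inst_at (get [set b | realizes b q])) psi)) A.

Lemma fibre_measureE (b : V -> U) q : realizes b q ->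
  fibre_measure q = restriction (fun psi => nu (subst (inst_at b) psi)) A.
Proof.
move=> bq; apply: restriction_eq => psi Apsi; rewrite -!inst_subst.
apply: (inst_equiv nu_invariant (@subset_refl _ A)) => //.
apply: (realizes_equiv (q := q)) => //.
by apply: (@getPex _ [set b | realizes b q]); exists b.
Qed.

Lemma fibre_measure_cyl q psi : formula_over A psi ->
  fibre_measure q (cyl A psi) = (fibre nu psi q)%:E.
Proof.
move=> Apsi; have [b bq] := realized U_monster q A_small.
rewrite (fibre_measureE bq) restriction_cyl//; last exact: keisler_subst.
by rewrite (fibreE nu_invariant _ Apsi bq)// inst_subst.
Qed.

Lemma fibre_measure_open q (W : set (type_space (Y + V)%type A)) (r : R) :
  open W -> (r%:E < fibre_measure q W)%E ->
  exists psi, [/\ formula_over A psi, cyl A psi `<=` W & r < fibre nu psi q].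
Proof.
move=> oW; have [b bq] := realized U_monster q A_small.
rewrite (fibre_measureE bq) restriction_open//; last exact: keisler_subst.
move=> /ereal_sup_gt[_ [psi [Apsi psiW] <-]]; rewrite lte_fin => rpsi.
exists psi; split=> //.
by rewrite (fibreE nu_invariant _ Apsi bq)// inst_subst.
Qed.

End FibreMeasure.

End FibreMeasures.

(** * Disintegration along the fibre measures *)

Section FibreMeasureIntegrals.
Variables (R : realType) (L : language) (T : set (sentence L)) (K : Type).
Variables (U : structure L) (A : set U).
Hypotheses (U_monster : monster K T U) (A_small : small K A).

Section Disintegration.
Variables (X Y V : finType) (mu : formula L (X + U) -> R).
Variable nu : formula L (Y + U) -> R.
Hypotheses (mu_def : borel_definable A mu) (nu_def : borel_definable A nu).
Hypothesis mu_or_nu_definable : definable A mu \/ definable A nu.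
Local Open Scope ereal_scope.
Local Notation SV := (type_space V A).
Local Notation SYV := (type_space (Y + V)%type A).
Local Notation fm := (fibre_measure (A := A) nu (V := V)).

Let nu_keisler := bdef_keisler nu_def.
Let nu_inv := bdef_invariant nu_def.
Let fm_cyl := @fibre_measure_cyl R L T K U A U_monster A_small Y V nu
  nu_keisler nu_inv.
Let fm_open := @fibre_measure_open R L T K U A U_monster A_small Y V nu
  nu_keisler nu_inv.

Let fm_fin (q : SV) (E : set (borel SYV)) : measurable E -> fm q E \is a fin_num.
Proof. exact: fin_num_measure. Qed.

(** On clopen sets, [m] is the mixture of the fibre measures with weight [rho]. When [rho] comes
    from [lambda], this is the defining formula of the product of [nu] and [lambda]; the lemmas
    below extend it beyond clopen sets. *)
Let mix_of (rho : probability (borel SV) R) (m : formula L ((Y + V)%type + U) -> R) :=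
  forall psi, formula_over A psi -> (m psi)%:E = \int[rho]_q (fibre nu psi q)%:E.

(** The value at [W] is the supremum of the fibre functions of the cylinders inside [W], which are
    continuous, so its superlevel sets are unions of open sets. *)
Lemma lsc_fibre_measure (W : set SYV) : definable A nu -> open W ->
  forall r, open [set q | (r < fine (fm q W))%R].
Proof.
move=> nu_definable oW r.
have mW := borel_open oW.
rewrite (_ : [set q | _] =
    \bigcup_(psi in [set psi | formula_over A psi /\ cyl A psi `<=` W])
    [set q : SV | (r < fibre nu psi q)%R]).
  apply: bigcup_open => psi [Apsi _].
  have /continuousP := continuous_fibre U_monster A_small nu_definable Apsi.
  by move=> /(_ _ (@open_gt _ r)).
apply/seteqP; split=> [q /= rq|q [psi [Apsi psiW] /= rpsi]].
  have [|psi [Apsi psiW rpsi]] := fm_open (q := q) (r := r) oW.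
    by rewrite -(fineK (fm_fin q mW)) lte_fin.
  by exists psi.
apply: (lt_le_trans rpsi); rewrite -lee_fin fineK ?fm_fin// -fm_cyl//.
by apply: le_measure; rewrite ?inE//; exact: measurable_cyl.
Qed.

Lemma mix_open (rho : probability (borel SV) R) (m : formula L ((Y + V)%type + U) -> R)
    (W : set SYV) :
  definable A nu -> regular_measure rho -> keisler m -> mix_of rho m -> open W ->
  restriction m A W = \int[rho]_q fm q W.
Proof.
move=> nu_definable rho_reg m_keisler mE oW.
have mW := borel_open oW.
have fmE : (fun q => fm q W) = (fun q => (fine (fm q W))%:E).
  by apply/funext => q; rewrite fineK// fm_fin.
have mfm : measurable_fun [set: borel SV] (fun q : borel SV => fm q W).
  rewrite fmE; apply/measurable_EFinP; apply: borel_measurable_lsc.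
  exact: lsc_fibre_measure.
have cyl_le psi : formula_over A psi -> cyl A psi `<=` W ->
    forall q, (fibre nu psi q)%:E <= fm q W.
  move=> Apsi psiW q; rewrite -fm_cyl//.
  by apply: le_measure; rewrite ?inE//; exact: measurable_cyl.
apply/eqP; rewrite eq_le; apply/andP; split.
  (* Upper bound: the measure of [W] is a supremum over cylinders inside [W], and each fibre
     function is bounded by the fibre measure of [W]. *)
  rewrite restriction_open//; apply: inner_content_le => psi Apsi psiW.
  rewrite mE//; apply: ge0_le_integral => //.
  - by move=> q _; rewrite lee_fin (fibre_ge0 nu_keisler).
  - by apply/measurable_EFinP; exact: (measurable_fibre U_monster nu_def).
  - by move=> q _; exact: cyl_le.
rewrite -[leRHS](fineK (fin_num_measure (restriction m A) W mW)).
rewrite fmE.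
(* Lower bound: monotone convergence along the cylinders inside [W], directed by disjunction. *)
apply: (@integral_directed_sup R SV _ rho
  [set psi | formula_over A psi /\ cyl A psi `<=` W] (fun psi q => fibre nu psi q)).
- exact: hausdorff_type_space.
- by move=> W' oW'; exact: (rho_reg _ (borel_open oW')).2.
- exists (FNot FTrue); split; first by apply/over_not; exact: over_true.
  by rewrite cyl_not ?cyl_true ?setCT//; exact: over_true.
- move=> psi r [Apsi _].
  have /continuousP := continuous_fibre U_monster A_small nu_definable Apsi.
  by move=> /(_ _ (@open_gt _ r)).
- move=> psi chi [Apsi psiW] [Achi chiW]; exists (FOr psi chi).
    by split; [exact: over_or|rewrite cyl_or// subUset].
  move=> q; have [b bq] := realized U_monster q A_small.
  rewrite !(fibreE nu_inv (@subset_refl _ A) _ bq)//; last exact: over_or.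
  by split; apply: keisler_le => // a; rewrite !sat_inst => ?; apply/sat_or; [left|right].
- move=> psi q [Apsi psiW]; rewrite (fibre_ge0 nu_keisler)/=.
  by rewrite -lee_fin fineK ?fm_fin//; exact: cyl_le.
- move=> q; rewrite -lee_fin fineK ?fm_fin//.
  exact: probability_le1.
- move=> q r rq; have [|psi [Apsi psiW rpsi]] := fm_open (q := q) (r := r) oW.
    by rewrite -(fineK (fm_fin q mW)) lte_fin.
  by exists psi.
- move=> psi [Apsi psiW]; rewrite -mE// -(restriction_cyl m_keisler Apsi).
  rewrite fineK ?fin_num_measure//.
  by apply: le_measure; rewrite ?inE//; exact: measurable_cyl.
Qed.

(* The cylinders if [mu] is definable and the open sets if [nu] is: on this
   pi-system the fibre measures depend measurably on the type, and the
   [fibre mu phi] are measurable for the sigma-algebra it generates. *)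
Lemma disintegration_system : exists G : set (set (borel SYV)),
  [/\ [/\ setI_closed G, G setT & G `<=` measurable],
    forall phi : formula L ((X + (Y + V))%type + U), formula_over A phi ->
      measurable_fun [set: g_sigma_algebraType G]
        (fibre mu (B := A) phi : g_sigma_algebraType G -> R),
    forall W, G W -> measurable_fun [set: borel SV] (fun q : borel SV => fm q W) &
    forall (rho : probability (borel SV) R) m, regular_measure rho -> keisler m ->
      mix_of rho m -> forall W, G W -> restriction m A W = \int[rho]_q fm q W].
Proof.
case: mu_or_nu_definable => [mu_definable|nu_definable].
  exists [set cyl A psi | psi in [set psi | formula_over A psi]]; split.
  - split.
    + move=> _ _ [psi Apsi <-] [chi Achi <-]; exists (FAnd psi chi).
        exact: over_and.
      exact: cyl_and.
    + by exists FTrue; [exact: over_true|exact: cyl_true].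
    + by move=> _ [psi Apsi <-]; exact: measurable_cyl.
  - move=> phi Aphi; apply: cyl_measurable_continuous.
    exact: (continuous_fibre U_monster A_small mu_definable Aphi).
  - move=> _ [psi Apsi <-].
    apply: (eq_measurable_fun (fun q : borel SV => (fibre nu psi q)%:E)).
      by move=> q _; rewrite fm_cyl.
    by apply/measurable_EFinP; exact: (measurable_fibre U_monster nu_def).
  - move=> rho m _ m_keisler mE _ [psi Apsi <-].
    rewrite restriction_cyl// mE//; apply: eq_integral => q _.
    by rewrite fm_cyl.
exists (open : set (set SYV)); split.
- split; [by move=> W W'; exact: openI|exact: openT|exact: borel_open].
- move=> phi Aphi; exact: (measurable_fibre U_monster mu_def).
- move=> W oW; have mW := borel_open oW.
  apply: (eq_measurable_fun (fun q : borel SV => (fine (fm q W))%:E)).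
    by move=> q _; rewrite fineK// fm_fin.
  apply/measurable_EFinP; apply: borel_measurable_lsc.
  exact: lsc_fibre_measure.
- by move=> rho m rho_reg m_keisler mE W oW; exact: mix_open.
Qed.

Variable phi : formula L ((X + (Y + V))%type + U).
Hypothesis Aphi : formula_over A phi.

Let fibre_mu_ge0 (p : SYV) : 0 <= (fibre mu phi p)%:E.
Proof. by rewrite lee_fin (fibre_ge0 (bdef_keisler mu_def)). Qed.

Lemma measurable_fibre_integral : measurable_fun [set: borel SV]
  (fun q : borel SV => \int[fm q]_p (fibre mu phi p)%:E).
Proof.
have [G [[GI GT Gm] Gmu Gfm _]] := disintegration_system.
apply: (measurable_kernel_integral GI GT Gm Gfm) => //.
by apply/measurable_EFinP; exact: Gmu.
Qed.

Lemma mix_disintegration (rho : probability (borel SV) R) m :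
  regular_measure rho -> keisler m -> mix_of rho m ->
  \int[restriction m A]_p (fibre mu phi p)%:E =
  \int[rho]_q \int[fm q]_p (fibre mu phi p)%:E.
Proof.
move=> rho_reg m_keisler mE.
have [G [[GI GT Gm] Gmu Gfm GmE]] := disintegration_system.
apply: (disintegration GI GT Gm Gfm) => //.
  by apply/measurable_EFinP; exact: Gmu.
exact: GmE.
Qed.

End Disintegration.

End FibreMeasureIntegrals.

(** * Borel definability of the product, and associativity *)

Section MorleyDefinability.
Variables (R : realType) (L : language) (T : set (sentence L)) (K : Type).
Variables (U : structure L) (A : set U).
Hypotheses (U_monster : monster K T U) (A_small : small K A).

Lemma integral_fibre_fin_num (X Y : finType) (mu : formula L (X + U) -> R)
    (P : probability (borel (type_space Y A)) R) (phi : formula L ((X + Y) + U)) :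
  borel_definable A mu -> formula_over A phi ->
  (\int[P]_q (fibre mu (B := A) phi q)%:E)%E \is a fin_num.
Proof.
move=> mu_def Aphi; apply: integrable_fin_num => //.
apply: bounded_integrable => [|q].
  exact: (measurable_fibre U_monster mu_def (@subset_refl _ A) A_small Aphi).
by rewrite (fibre_ge0 (bdef_keisler mu_def)) (fibre_le1 (bdef_keisler mu_def)).
Qed.

Section Morley.
Variables (X Y : finType) (mu : formula L (X + U) -> R).
Variable nu : formula L (Y + U) -> R.
Hypotheses (mu_def : borel_definable A mu) (nu_def : borel_definable A nu).

Let nu_keisler := bdef_keisler nu_def.
Let nu_inv := bdef_invariant nu_def.

(** After reassociation, instantiating [V] at [b] is a substitution in the block [Y + V], so
    [morley_subst] applies, and the measure it produces is the fibre measure at [q]. The right-hand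
    side mentions only the type of [b], whence invariance. *)
Lemma morley_inst (V : finType) (phi : formula L (((X + Y) + V) + U))
    (b : V -> U) (q : type_space V A) :
  formula_over A phi -> realizes b q ->
  morley A mu nu (inst phi b) =
  \int[fibre_measure nu q]_p fibre mu (B := A) (reassoc phi) p.
Proof.
move=> Aphi bq; rewrite inst_reassoc (morley_subst U_monster A_small)//.
  by rewrite (fibre_measureE nu_inv bq).
exact: over_reassoc.
Qed.

Lemma morley_invariant : invariant_over A (morley A mu nu).
Proof.
move=> V phi b b' bb'.
have Aphi : formula_over A (no_params U phi) by exact: over_no_params.
have bq : realizes b (tp A b) by move=> psi [].
by rewrite (morley_inst Aphi bq) (morley_inst Aphi (equiv_realizes bb' bq)).
Qed.

Lemma fibre_morley (V : finType) (phi : formula L (((X + Y) + V) + U))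
    (q : type_space V A) : formula_over A phi ->
  fibre (morley A mu nu) phi q =
  \int[fibre_measure nu q]_p fibre mu (B := A) (reassoc phi) p.
Proof.
move=> Aphi; have [b bq] := realized U_monster q A_small.
by rewrite (fibreE morley_invariant (@subset_refl _ A) Aphi bq) (morley_inst Aphi bq).
Qed.

Hypothesis mu_or_nu_definable : definable A mu \/ definable A nu.

Lemma morley_borel_definable : borel_definable A (morley A mu nu).
Proof.
split; last move=> V phi.
- exact (keisler_morley U_monster A_small mu_def nu_keisler).
- exact: morley_invariant.
have Aphi : formula_over A (no_params U phi) by exact: over_no_params.
rewrite (_ : fibre _ _ = fun q : borel (type_space V A) =>
    fine (\int[fibre_measure nu q]_p
      (fibre mu (B := A) (reassoc (no_params U phi)) p)%:E)).
  apply: (measurableT_comp (f := fine)) => //.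
  exact: (measurable_fibre_integral U_monster A_small mu_def nu_def
    mu_or_nu_definable (over_reassoc Aphi)).
by apply/funext => q; rewrite fibre_morley.
Qed.

End Morley.

End MorleyDefinability.

Theorem theorem2p18 (R : realType) (L : language) (T : set (sentence L))
    (K : Type) (U : structure L) (X Y Z : finType) (A : set U)
    (mu : formula L (X + U) -> R) (nu : formula L (Y + U) -> R)
    (T_complete : complete_theory T) (U_monster : monster K T U)
    (A_small : small K A)
    (mu_borel : borel_definable A mu) (nu_borel : borel_definable A nu)
    (mu_or_nu_definable : definable A mu \/ definable A nu) :
  borel_definable A (morley A mu nu) /\
  forall lambda : formula L (Z + U) -> R, keisler lambda ->
    forall phi : formula L (((X + Y) + Z) + U),
      morley A (morley A mu nu) lambda phi =
      morley A mu (morley A nu lambda) (reassoc phi).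
Proof.
have munu_borel := morley_borel_definable U_monster A_small mu_borel nu_borel
  mu_or_nu_definable.
split=> // lambda lambda_keisler phi.
(* The parameters of [phi] are named by variables next to [Z], so that both sides become integrals
   over types over [A]. *)
have [n [g [phi0 [_ ->]]]] := name_params phi.
have Aphi0 : formula_over A (no_params U phi0) by exact: over_no_params.
rewrite reassoc_subst (morley_subst U_monster A_small munu_borel lambda_keisler)//.
have nulambda_keisler := keisler_morley U_monster A_small nu_borel lambda_keisler.
rewrite (morley_subst U_monster A_small mu_borel nulambda_keisler); last first.
  exact: over_reassoc.
have lambdag_keisler := keisler_subst g lambda_keisler.
(* [rho] is the measure on types over [A] given by [lambda] with the parameters substituted through
   [g]; the left-hand side is an integral against it. *)
set rho := restriction _ A.
have rho_reg : regular_measure rho := (restriction_spec A lambdag_keisler).1.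
rewrite /Rintegral.
rewrite (mix_disintegration U_monster A_small mu_borel nu_borel
  mu_or_nu_definable (over_reassoc Aphi0) rho_reg (keisler_subst _ nulambda_keisler)).
  (* The inner integral at [q] is the fibre function of [morley A mu nu], which is the integrand on
     the left. [fineK] needs it to be finite. *)
  congr fine; apply: eq_integral => q _.
  rewrite (fibre_morley U_monster A_small mu_borel nu_borel)// /Rintegral fineK//.
  exact: (integral_fibre_fin_num U_monster A_small _ mu_borel (over_reassoc Aphi0)).
(* What is left is [mix_of], which is [morley_subst] for the product of [nu] and [lambda]. *)
move=> psi Apsi.
rewrite (morley_subst U_monster A_small nu_borel lambda_keisler)// /Rintegral fineK//.
exact: (integral_fibre_fin_num U_monster A_small _ nu_borel Apsi).
Qed.
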